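(* Let $C>1$ and $0\le\alpha<\beta<1$, and equip the space $\mathcal{F}_{(C,\beta)}$ with the topology of the metric $d_\alpha$. There exists a residual set $\mathcal{R}\subseteq\mathcal{F}_{(C,\beta)}$ such that for all $f\in\mathcal{R}$, the foliation $\mathcal{P}_f$ is non-absolutely continuous. Furthermore, for every $f\in\mathcal{R}$ and for $\hat\mu$-a.e. $P\in\mathcal{P}_f$, the conditional measure $\mu_P$ of $\mu$ relative to $P$ is mono-atomic (i.e. $\mu_P$ is a Dirac measure at a point of $P$).
   Context: $M=[0,1]^2$ and $\mu$ is Lebesgue measure on $M$. For $C>1$ and $0<\beta<1$, $\mathcal{F}_{(C,\beta)}$ is the set of functions $f:M\to\mathbb{R}$ such that: $f$ is $C^1$ uniformly in the first variable (i.e. $\partial f/\partial x$ exists and is continuous on $M$); $f(0,y)=y$ for all $y\in[0,1]$; $f(x,0)=0$ and $f(x,1)=1$ for all $x\in[0,1]$; and $f$ is $(C,\beta)$-bi-Hölder in the second variable: for all $x\in[0,1]$ and all $y_1\neq y_2$ in $[0,1]$, $$C^{-1}|y_2-y_1|^{1/\beta}\le |f(x,y_2)-f(x,y_1)|\le C|y_2-y_1|^{\beta}.$$ For such $f$, write $h^f_{0,x}=f(x,\cdot):[0,1]\to[0,1]$ and $h^f_{x,0}=f(x,\cdot)^{-1}$. For $0\le\alpha<\beta$ the metric is $$d_\alpha(f,g)=\|f-g\|_{C^0}+\left\|\frac{\partial f}{\partial x}-\frac{\partial g}{\partial x}\right\|_{C^0}+\sup_{x\in[0,1]}\left\{\|h^f_{0,x}-h^g_{0,x}\|_\alpha,\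 \|h^f_{x,0}-h^g_{x,0}\|_\alpha\right\},$$ where $\|f\|_{C^0}=\sup_{(x,y)\in M}|f(x,y)|$ and $\|h\|_\alpha=\sup_{y_1\ne y_2\in[0,1]}\frac{|h(y_2)-h(y_1)|}{|y_2-y_1|^\alpha}$ (the last supremum in $d_\alpha$ is over all $x$ and over both quantities). A set is residual if it is a countable intersection of open dense sets. Each $f\in\mathcal{F}_{(C,\beta)}$ defines a foliation (measurable partition) $\mathcal{P}_f$ of $M$ whose elements (leaves) are the graphs $\{(x,f(x,y)):x\in[0,1]\}$, $y\in[0,1]$. Disintegration: let $\pi:M\to\mathcal{P}_f$ send a point to the element containing it. A subset $\mathcal{Q}\subset\mathcal{P}_f$ is measurable if $\pi^{-1}(\mathcal{Q})$ is measurable, and $\hat\mu(\mathcal{Q})=\mu(\pi^{-1}(\mathcal{Q}))$. The conditional measures $\{\mu_P:P\in\mathcal{P}_f\}$ are the ($\hat\mu$-a.e. unique) family of probability measures on $M$ such that for every measurable $E\subset M$: $\mu_P(P)=1$ for $\hat\mu$-a.e. $P$; $P\mapsto\mu_P(E)$ is measurable; and $\mu(E)=\int\mu_P(E)\,d\hat\mu(P)$ (they exist by Rokhlin's theorem). Absolute continuity: a foliation $\mathcal{F}$ is absolutely continuous if for any pair of smooth transversals $\tau_1,\tau_2$ to the foliation, the $\mathcal{F}$-holonomy $h_{\mathcal{F}}$ from $\tau_1$ to $\tau_2$ (moving points along leaves) is absolutely continuous with respect to the induced Riemannian measures $\lambda_{\tau_1},\lambda_{\tau_2}$: if $A\subset\tau_1$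 and $\lambda_{\tau_1}(A)=0$, then $\lambda_{\tau_2}(h_{\mathcal{F}}(A))=0$. Non-absolutely continuous means not absolutely continuous. *)

(* Defs.v *)
From HB Require Import structures.
From mathcomp Require Import all_boot all_order all_algebra.
From mathcomp Require Import all_classical all_reals all_analysis.
From mathcomp Require Import measurable_realfun.

Set Implicit Arguments.
Unset Strict Implicit.
Unset Printing Implicit Defensive.

Import Order.TTheory GRing.Theory Num.Def Num.Theory.
Import numFieldTopology.Exports numFieldNormedType.Exports.

Local Open Scope classical_set_scope.
Local Open Scope ring_scope.

Definition residual (T : topologicalType) (A : set T) :=
  exists2 U : (set T)^nat,
    forall n, open (U n) /\ dense (U n) & A = \bigcap_n U n.

(* measurableTypeR R is R with its Borel sigma-algebra. *)
Notation plane R := (measurableTypeR R * measurableTypeR R)%type.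

Definition unit_square (R : realType) : set (R * R) := `[0, 1] `*` `[0, 1].
Arguments unit_square {R}.

Section function_space.
Context {R : realType}.
Implicit Types (f g : R * R -> R) (C beta alpha : R).

Definition diff_quot_x f (p : R * R) (h : R) : R :=
  h^-1 * (f (p.1 + h, p.2) - f p).

(* Increments are restricted so as to stay in [0, 1]: the derivative is
   one-sided at p.1 = 0 and at p.1 = 1. *)
Definition incr_x (p : R * R) : set_system R :=
  within [set h : R | p.1 + h \in `[0, 1]] 0^'.

Definition derivable_x f (p : R * R) := cvg (diff_quot_x f p @ incr_x p).

Definition partial_x f (p : R * R) : R := lim (diff_quot_x f p @ incr_x p).

Definition C1_in_x f :=
  (forall p, unit_square p -> derivable_x f p) /\
  {within unit_square, continuous (partial_x f)}.

Definition bi_holder C beta f := forall x y1 y2 : R,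
  x \in `[0, 1] -> y1 \in `[0, 1] -> y2 \in `[0, 1] -> y1 != y2 ->
  C^-1 * `|y2 - y1| `^ beta^-1 <= `|f (x, y2) - f (x, y1)|
                               <= C * `|y2 - y1| `^ beta.

(* A function on the unit square is represented by its extension by 0 to the
   plane, so that equality is equality of functions on the square. *)
Record bihol_space C beta alpha := BiholSpace {
  bihol_fun :> R * R -> R ;
  bihol_out : forall p, ~ unit_square p -> bihol_fun p = 0 ;
  bihol_C1 : C1_in_x bihol_fun ;
  bihol_left : forall y, y \in `[0, 1] -> bihol_fun (0, y) = y ;
  bihol_bot : forall x, x \in `[0, 1] -> bihol_fun (x, 0) = 0 ;
  bihol_top : forall x, x \in `[0, 1] -> bihol_fun (x, 1) = 1 ;
  bihol_bi_holder : bi_holder C beta bihol_fun }.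

Definition holonomy0x f (x : R) : R -> R := fun y => f (x, y).

Definition holonomyx0 f (x : R) : R -> R :=
  'pinv_(fun=> 0) `[0, 1] (holonomy0x f x).

Local Open Scope ereal_scope.

Definition C0_norm (u : R * R -> R) : \bar R :=
  ereal_sup [set (`|u p|%R)%:E | p in unit_square].

Definition holder_norm alpha (h : R -> R) : \bar R :=
  ereal_sup [set r | exists y1 y2 : R,
    [/\ y1 \in `[0, 1]%R, y2 \in `[0, 1]%R, y1 != y2 &
        r = (`|h y2 - h y1| / `|y2 - y1| `^ alpha)%R%:E]].

Definition holonomy_dist alpha f g : \bar R := ereal_sup
    ([set holder_norm alpha (holonomy0x f x \- holonomy0x g x)%R
        | x in `[0%R, 1%R]] `|`
     [set holder_norm alpha (holonomyx0 f x \- holonomyx0 g x)%R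
        | x in `[0%R, 1%R]]).

(* All the suprema are finite when f and g are in the same bihol_space and
   alpha < beta. *)
Definition dist_alpha alpha f g : \bar R :=
  C0_norm (f \- g)%R + C0_norm (partial_x f \- partial_x g)%R +
  holonomy_dist alpha f g.

Lemma C0_norm_ge0 u : 0 <= C0_norm u.
Proof.
apply: le_trans (ereal_sup_ubound _); last first.
  exists (0, 0)%R => //; split; rewrite /= in_itv /= lexx ler01 //.
by rewrite lee_fin.
Qed.

Lemma C0_norm0 u : (forall p, u p = 0%R) -> C0_norm u = 0.
Proof.
move=> u0; apply/eqP; rewrite eq_le C0_norm_ge0 andbT.
by apply: ge_ereal_sup => _ [p _ <-]; rewrite u0 normr0.
Qed.

Lemma C0_normN u v : (forall p, u p = - v p)%R -> C0_norm u = C0_norm v.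
Proof.
move=> uv; congr ereal_sup; apply: eq_imagel => p _.
by rewrite uv normrN.
Qed.

Lemma C0_normD u v w : (forall p, w p = u p + v p)%R ->
  C0_norm w <= C0_norm u + C0_norm v.
Proof.
move=> wE; apply: ge_ereal_sup => _ [p Mp <-].
apply: (@le_trans _ _ ((`|u p|%R)%:E + (`|v p|%R)%:E)).
  by rewrite -EFinD lee_fin wE ler_normD.
by apply: leeD; apply: ereal_sup_ubound; exists p.
Qed.

Lemma holder_norm_ge0 alpha h : 0 <= holder_norm alpha h.
Proof.
apply: le_trans (ereal_sup_ubound _); last first.
  exists 0%R, 1%R; split=> //; rewrite ?in_itv /= ?lexx ?ler01 //.
  by rewrite eq_sym oner_eq0.
by rewrite lee_fin divr_ge0 // powR_ge0.
Qed.

Lemma holder_norm0 alpha h : (forall y, h y = 0%R) -> holder_norm alpha h = 0.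
Proof.
move=> h0; apply/eqP; rewrite eq_le holder_norm_ge0 andbT.
apply: ge_ereal_sup => _ [y1] [y2] [_ _ _ ->].
by rewrite !h0 subrr normr0 mul0r.
Qed.

Lemma holder_normN alpha h k :
  (forall y, h y = - k y)%R -> holder_norm alpha h = holder_norm alpha k.
Proof.
move=> hk; rewrite /holder_norm; congr ereal_sup; apply/seteqP.
by split=> _ [y1] [y2] [? ? ? ->]; exists y1, y2; split=> //;
  rewrite !hk -opprD normrN.
Qed.

Lemma holder_normD alpha h k l : (forall y, l y = h y + k y)%R ->
  holder_norm alpha l <= holder_norm alpha h + holder_norm alpha k.
Proof.
move=> lE; apply: ge_ereal_sup => _ [y1] [y2] [Iy1 Iy2 y12 ->].
apply: (@le_trans _ _ ((`|h y2 - h y1| / `|y2 - y1| `^ alpha)%R%:E +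
                       (`|k y2 - k y1| / `|y2 - y1| `^ alpha)%R%:E)).
  rewrite -EFinD lee_fin -mulrDl ler_wpM2r ?invr_ge0 ?powR_ge0 // !lE.
  by rewrite opprD addrACA ler_normD.
by apply: leeD; apply: ereal_sup_ubound; exists y1, y2.
Qed.

Lemma holonomy_dist_ge0 alpha f g : 0 <= holonomy_dist alpha f g.
Proof.
apply: le_trans (ereal_sup_ubound _); last first.
  by left; exists 0%R => //=; rewrite in_itv /= lexx ler01.
exact: holder_norm_ge0.
Qed.

Lemma dist_alpha_ge0 alpha f g : 0 <= dist_alpha alpha f g.
Proof.
by rewrite !adde_ge0 ?C0_norm_ge0 //; exact: (holonomy_dist_ge0 alpha f g).
Qed.

Lemma dist_alphaxx alpha f : dist_alpha alpha f f = 0.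
Proof.
rewrite /dist_alpha !C0_norm0 ?adde0 ?add0e; last 2 first.
- by move=> p /=; rewrite subrr.
- by move=> p /=; rewrite subrr.
apply/eqP; rewrite eq_le (holonomy_dist_ge0 alpha f f) andbT.
apply: ge_ereal_sup => _ [] [x _ <-];
  by rewrite holder_norm0 // => y /=; rewrite subrr.
Qed.

Lemma dist_alpha_sym alpha f g : dist_alpha alpha f g = dist_alpha alpha g f.
Proof.
rewrite /dist_alpha; congr (_ + _ + ereal_sup (_ `|` _)).
- by apply: C0_normN => p /=; rewrite opprB.
- by apply: C0_normN => p /=; rewrite opprB.
- by apply: eq_imagel => x _; apply: holder_normN => y /=; rewrite opprB.
- by apply: eq_imagel => x _; apply: holder_normN => y /=; rewrite opprB.
Qed.

Lemma dist_alpha_triangle alpha g f k :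
  dist_alpha alpha f k <= dist_alpha alpha f g + dist_alpha alpha g k.
Proof.
have H : holonomy_dist alpha f k <=
         holonomy_dist alpha f g + holonomy_dist alpha g k.
  apply: ge_ereal_sup => _ [] [x Ix <-].
  - apply: le_trans (_ : _ <=
      holder_norm alpha (holonomy0x f x \- holonomy0x g x)%R +
      holder_norm alpha (holonomy0x g x \- holonomy0x k x)%R) _.
      by apply: holder_normD => y /=; rewrite addrA subrK.
    by apply: leeD; apply: ereal_sup_ubound; left; exists x.
  - apply: le_trans (_ : _ <=
      holder_norm alpha (holonomyx0 f x \- holonomyx0 g x)%R +
      holder_norm alpha (holonomyx0 g x \- holonomyx0 k x)%R) _.
      by apply: holder_normD => y /=; rewrite addrA subrK.
    by apply: leeD; apply: ereal_sup_ubound; right; exists x.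
rewrite /dist_alpha addeACA; apply: leeD H.
rewrite addeACA; apply: leeD; apply: C0_normD => p /=;
  by rewrite addrA subrK.
Qed.

End function_space.

Section topology.
Context {R : realType} (C beta alpha : R).
Local Notation T := (bihol_space C beta alpha).

HB.instance Definition _ := gen_eqMixin T.
HB.instance Definition _ := gen_choiceMixin T.

Definition bihol_ball (f : T) (e : R) : set T :=
  [set g : T | (dist_alpha alpha f g < e%:E)%E].

Definition bihol_ent : set_system (T * T) := entourage_ bihol_ball.

Definition bihol_nbhs (f : T) : set_system T := nbhs_ bihol_ent f.

Lemma bihol_nbhsE : bihol_nbhs = nbhs_ bihol_ent. Proof. by []. Qed.

HB.instance Definition _ := hasNbhs.Build T bihol_nbhs.

Lemma bihol_ball_center (f : T) (e : R) : 0 < e -> bihol_ball f e f.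
Proof. by move=> e0; rewrite /bihol_ball /= dist_alphaxx lte_fin. Qed.

Lemma bihol_ball_sym (f g : T) (e : R) : bihol_ball f e g -> bihol_ball g e f.
Proof. by rewrite /bihol_ball /= dist_alpha_sym. Qed.

Lemma bihol_ball_triangle (f g k : T) (e1 e2 : R) :
  bihol_ball f e1 g -> bihol_ball g e2 k -> bihol_ball f (e1 + e2) k.
Proof.
rewrite /bihol_ball /= => fg gk; apply: le_lt_trans (dist_alpha_triangle _ g _ _) _.
by rewrite EFinD lteD.
Qed.

Lemma bihol_entourageE : bihol_ent = entourage_ bihol_ball. Proof. by []. Qed.

HB.instance Definition _ := @Nbhs_isPseudoMetric.Build R T
  bihol_ent bihol_nbhsE bihol_ball bihol_ball_center bihol_ball_sym
  bihol_ball_triangle bihol_entourageE.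

End topology.

Section foliation.
Context {R : realType} (f : R * R -> R).

Definition leaf (y : R) : set (R * R) :=
  [set (x, f (x, y)) | x in `[0, 1]].

Definition foliation : set (set (R * R)) := [set leaf y | y in `[0, 1]].

Definition leaf_space : Type := {P : set (R * R) | foliation P}.

Lemma foliation_leaf0 : foliation (leaf 0).
Proof. by exists 0 => //=; rewrite in_itv /= lexx ler01. Qed.

HB.instance Definition _ := gen_eqMixin leaf_space.
HB.instance Definition _ := gen_choiceMixin leaf_space.
HB.instance Definition _ := isPointed.Build leaf_space
  (exist foliation (leaf 0) foliation_leaf0).

Definition leaf_of (p : R * R) : leaf_space :=
  get [set P : leaf_space | sval P p].

Definition holonomy_image (tau A : set (R * R)) : set (R * R) :=
  [set q | tau q /\ exists p P, [/\ A p, foliation P, P p & P q]].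

(* A smooth transversal is a compact C^oo arc gamma([0, 1]) in the square,
   given by a parametrization that is smooth on the line.  At a point of the
   leaf of y, the tangent direction of this leaf is (1, partial_x f (x, y)); in
   particular transversality implies that gamma is an immersion. *)
Definition smooth (u : R -> R) := forall n t, derivable (derive1n n u) t 1.

Definition smooth_transversal (gamma : R -> R * R) :=
  [/\ smooth (fst \o gamma) /\ smooth (snd \o gamma),
      set_inj `[0, 1] gamma,
      gamma @` `[0, 1] `<=` unit_square &
      forall t y : R, t \in `[0, 1] -> y \in `[0, 1] -> leaf y (gamma t) ->
        derive1 (snd \o gamma) t !=
        partial_x f ((gamma t).1, y) * derive1 (fst \o gamma) t].

Definition arc_length (gamma : R -> R * R) (A : set (R * R)) : \bar R :=
  (\int[@lebesgue_measure R]_(t in `[0%R, 1%R] `&` gamma @^-1` A)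
    (Num.sqrt (derive1 (fst \o gamma) t ^+ 2 + derive1 (snd \o gamma) t ^+ 2))%:E)%E.

Definition absolutely_continuous_foliation :=
  forall gamma1 gamma2 : R -> R * R,
    smooth_transversal gamma1 -> smooth_transversal gamma2 ->
  forall A : set (plane R), A `<=` gamma1 @` `[0, 1] ->
    (arc_length gamma1).-negligible A ->
    (arc_length gamma2).-negligible
      (holonomy_image (gamma2 @` `[0, 1]) A : set (plane R)).

End foliation.

Section disintegration.
Context {R : realType} (f : R * R -> R).

Lemma measurable_unit_square : measurable (unit_square : set (plane R)).
Proof. by apply: measurableX; exact: measurable_itv. Qed.

Definition square_measure : set (plane R) -> \bar R :=
  mrestr (@lebesgue_measure R \x @lebesgue_measure R)%E measurable_unit_square.

HB.instance Definition _ := Measure.on square_measure.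

Fact leaf_display : measure_display. Proof. by []. Qed.

Definition leaf_measurable : set (set (leaf_space f)) :=
  [set Q | measurable (unit_square `&` leaf_of f @^-1` Q : set (plane R))].

Lemma leaf_measurable0 : leaf_measurable set0.
Proof. by rewrite /leaf_measurable /= preimage_set0 setI0. Qed.

Lemma leaf_measurableC Q : leaf_measurable Q -> leaf_measurable (~` Q).
Proof.
rewrite /leaf_measurable /= preimage_setC => mQ.
rewrite (_ : _ `&` _ =
  unit_square `\` (unit_square `&` leaf_of f @^-1` Q)); last first.
  by rewrite setDIr setDv set0U.
exact: measurableD measurable_unit_square mQ.
Qed.

Lemma leaf_measurable_bigcup (F : (set (leaf_space f))^nat) :
  (forall i, leaf_measurable (F i)) -> leaf_measurable (\bigcup_i F i).
Proof.
rewrite /leaf_measurable /= => mF; rewrite preimage_bigcup setI_bigcupr.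
exact: bigcup_measurable.
Qed.

HB.instance Definition _ := isMeasurable.Build leaf_display (leaf_space f)
  leaf_measurable0 leaf_measurableC leaf_measurable_bigcup.

Definition leaf_measure (Q : set (leaf_space f)) : \bar R :=
  square_measure (unit_square `&` leaf_of f @^-1` Q).

Lemma leaf_measure0 : leaf_measure set0 = 0%E.
Proof. by rewrite /leaf_measure preimage_set0 setI0 measure0. Qed.

Lemma leaf_measure_ge0 Q : (0 <= leaf_measure Q)%E.
Proof. exact: measure_ge0. Qed.

Lemma leaf_measure_sigma_additive : semi_sigma_additive leaf_measure.
Proof.
move=> F mF tF mUF; rewrite /leaf_measure preimage_bigcup setI_bigcupr.
apply: measure_semi_sigma_additive => //.
- apply/trivIsetP => i j _ _ ij.
  move/trivIsetP : tF => /(_ i j Logic.I Logic.I ij) Fij.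
  by rewrite setIACA -preimage_setI Fij preimage_set0 setI0.
- by rewrite -setI_bigcupr -preimage_bigcup.
Qed.

HB.instance Definition _ := isMeasure.Build _ _ _ leaf_measure
  leaf_measure0 leaf_measure_ge0 leaf_measure_sigma_additive.

Definition conditional_measures (mu_ : leaf_space f -> probability (plane R) R) :=
  [/\ forall P, mu_ P unit_square = 1%E,
      {ae leaf_measure, forall P, mu_ P (sval P) = 1%E},
      forall E : set (plane R), measurable E -> E `<=` unit_square ->
        measurable_fun setT (fun P => mu_ P E) &
      forall E : set (plane R), measurable E -> E `<=` unit_square ->
        (square_measure E = \int[leaf_measure]_P mu_ P E)%E].

Definition mono_atomic (P : leaf_space f) (nu : probability (plane R) R) :=
  exists2 p : plane R, sval P p &
    forall E : set (plane R), measurable E -> nu E = \d_p E.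

End disintegration.
Arguments leaf_measure {R} f.
Arguments mono_atomic {R f}.

(* Main.v *)
(* Interpolating Hoelder norms shows that d_alpha has the topology of uniform
   convergence of f and of its x-derivative.  For 0 <= a < b, ask that some finite
   union B of intervals be such that the leaves starting in B fill at most a
   proportion eta of every vertical {x} x [0, 1] with x <= a, and at least 1 - eta
   when x >= b.  This condition is open.  It is dense: first make f bi-Lipschitz
   in y, by piecewise linear interpolation (which by Jensen preserves the Hoelder
   bounds) followed by averaging with the identity (which makes these bounds
   strict); then replace f (x, y) by (1 - w x) f (x, y) + w x f (x, T y), where w is
   a C^1 step from 0 on [0, a] to 1 on [b, 1] and T is a 1/N-periodic piecewise
   linear homeomorphism that expands [j/N, (j+e)/N] to almost all of its cell.
   The Lipschitz bounds of the result do not depend on N, so they imply the Hoelder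
   bounds at small scales; at large scales the result is close to f.

   If f satisfies these conditions for all rational a < b and all eta = 2^-m, then
   by Borel-Cantelli there is for all a < b a leaf-saturated set E that is null on
   the verticals with x <= a and conull on those with x >= b.  For a = 0 and b = 1
   this contradicts absolute continuity.  Moreover every leaf lies in E or in its
   complement, so almost every conditional measure is null on x <= a or on x >= b;
   as this holds for all rational a < b, it is a Dirac measure. *)

Require Import Defs.
From mathcomp Require Import all_boot all_order all_algebra.
From mathcomp Require Import all_classical all_reals all_analysis.
From mathcomp Require Import measurable_realfun.
From mathcomp Require Import ring lra.
Import Order.TTheory GRing.Theory Num.Theory.
Import numFieldTopology.Exports numFieldNormedType.Exports.
Local Open Scope classical_set_scope.
Local Open Scope ring_scope.

(** * Functions that are C^1 in the first variable *)

Lemma unit_squareP {R : realType} (x y : R) :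
  unit_square (x, y) <-> (0 <= x <= 1) /\ (0 <= y <= 1).
Proof. by rewrite /unit_square /setX /= !in_itv /=. Qed.

Section C1x.
Context {R : realType}.
Implicit Types (F G DF DG : R * R -> R) (p : R * R).

#[local] Instance incr_x_filter p : Filter (incr_x p).
Proof. exact: within_filter. Qed.

(** In the left half of the square small positive increments are admissible, in the right half small
    negative ones; hence the bound 1/2 on [d]. Properness is what makes the limit in [partial_x]
    unique. *)
Lemma incr_x_proper p : unit_square p -> ProperFilter (incr_x p).
Proof.
case: p => x y /unit_squareP[/andP[x0 x1] _].
apply: Build_ProperFilter_ex => P [e /= e0 eP].
pose d : R := Num.min (e / 2) (1 / 2).
have d0 : 0 < d by rewrite lt_min !divr_gt0.
have de : d < e by rewrite gt_min ltr_pdivrMr // ltr_pMr // ltr1n.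
have d2 : d <= 1 / 2 by rewrite ge_min lexx orbT.
have [x2|x2] := leP x (1 / 2).
  exists d; apply: eP; rewrite /= ?in_itv /= ?sub0r ?normrN ?gtr0_norm //.
    by rewrite gt_eqF.
  by lra.
exists (- d); apply: eP; rewrite /= ?in_itv /= ?sub0r ?opprK ?gtr0_norm //.
  by rewrite oppr_eq0 gt_eqF.
by lra.
Qed.

Lemma shift_incr_x p : unit_square p ->
  (fun h : R => (p.1 + h, p.2)) @ incr_x p --> within unit_square (nbhs p).
Proof.
case: p => x y /unit_squareP[_ y01] /= P /nbhs_ballP[e /= e0 eP].
exists e => //= h /= he h0 hI; apply: eP.
  split => /=; last exact: ballxx.
  by rewrite /ball /= opprD addNKr normrN; rewrite sub0r normrN in he.
by apply/unit_squareP; split => //; rewrite in_itv in hI.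
Qed.

(** Carrying the derivative [DF] as data lets the rules below compute it without going through the
    [lim] in [partial_x]. Continuity of [F] is included for the sake of the product rule. *)
Definition C1x F DF :=
  [/\ {within unit_square, continuous F}, {within unit_square, continuous DF} &
      forall p, unit_square p -> diff_quot_x F p @ incr_x p --> DF p].

Lemma C1xD F DF G DG : C1x F DF -> C1x G DG ->
  C1x (fun p => F p + G p) (fun p => DF p + DG p).
Proof.
move=> [/subspace_continuousP cF /subspace_continuousP cDF dF].
move=> [/subspace_continuousP cG /subspace_continuousP cDG dG].
split; [apply/subspace_continuousP| apply/subspace_continuousP|] => p Mp.
- exact: cvgD (cF _ Mp) (cG _ Mp).
- exact: cvgD (cDF _ Mp) (cDG _ Mp).
- rewrite (_ : diff_quot_x _ p = diff_quot_x F p \+ diff_quot_x G p).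
    exact: cvgD (dF _ Mp) (dG _ Mp).
  by apply/funext => h; rewrite /diff_quot_x /=; ring.
Qed.

Lemma C1xM F DF G DG : C1x F DF -> C1x G DG ->
  C1x (fun p => F p * G p) (fun p => DF p * G p + F p * DG p).
Proof.
move=> [/subspace_continuousP cF /subspace_continuousP cDF dF].
move=> [/subspace_continuousP cG /subspace_continuousP cDG dG].
split; [apply/subspace_continuousP| apply/subspace_continuousP|] => p Mp.
- exact: cvgM (cF _ Mp) (cG _ Mp).
- exact: cvgD (cvgM (cDF _ Mp) (cG _ Mp)) (cvgM (cF _ Mp) (cDG _ Mp)).
(* The product increment is split with the shifted value [Gp] of the second factor, which tends to
   [G p] by [shift_incr_x]. *)
- pose Gp h := G (p.1 + h, p.2).
  rewrite (_ : diff_quot_x _ p = diff_quot_x F p \* Gp \+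
                                 (fun=> F p) \* diff_quot_x G p); last first.
    by apply/funext => h; rewrite /diff_quot_x /Gp /=; ring.
  apply: cvgD; apply: cvgM.
  + exact: dF.
  + exact: (cvg_comp _ _ (shift_incr_x _ Mp) (cG _ Mp)).
  + exact: cvg_cst.
  + exact: dG.
Qed.

Lemma C1x_y (phi : R -> R) : {within `[0, 1], continuous phi} ->
  C1x (fun p => phi p.2) (fun=> 0).
Proof.
move=> /subspace_continuousP cphi.
split; [apply/subspace_continuousP| |] => [[x y] Mp| |p Mp].
- apply: cvg_comp (cphi _ (proj2 Mp)) => /= P /nbhs_ballP[e /= e0 eP].
  by apply/nbhs_ballP; exists e => //= q [_ q2] [_ Mq2]; apply: eP.
- by apply: continuous_subspaceT => p; exact: cst_continuous.
- rewrite (_ : diff_quot_x _ p = fun=> 0); first exact: cvg_cst.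
  by apply/funext => h; rewrite /diff_quot_x /= subrr mulr0.
Qed.

Lemma C1x_cst (c : R) : C1x (fun=> c) (fun=> 0).
Proof.
apply: (C1x_y (fun=> c)).
by apply: continuous_subspaceT => ?; exact: cst_continuous.
Qed.

Lemma C1x_x (w dw : R -> R) : (forall x : R, is_derive x 1 w (dw x)) ->
  continuous dw -> C1x (fun p => w p.1) (fun p => dw p.1).
Proof.
move=> wd cdw.
have cw : continuous w.
  by move=> x; apply: differentiable_continuous; apply/derivable1_diffP.
split.
- by apply: continuous_subspaceT => -[x y]; apply: (@continuous_comp _ _ _ fst w (x, y)); [exact: cvg_fst|exact: cw].
- by apply: continuous_subspaceT => -[x y]; apply: (@continuous_comp _ _ _ fst dw (x, y)); [exact: cvg_fst|exact: cdw].
- move=> [x y] Mp; have [dx <-] := wd x.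
  rewrite (_ : diff_quot_x _ _ = fun h => h^-1 *: (w (h *: 1 + x) - w x)).
    have Dw : (h^-1 *: (w (h *: 1 + x) - w x)) @[h --> 0^'] --> 'D_1 w x by exact: dx.
    by apply: cvg_trans Dw; apply: cvg_fmap2; exact: cvg_within.
  apply/funext => h; rewrite /diff_quot_x /=.
  by have -> : h *: 1 + x = x + h :> R by rewrite addrC scaler1.
Qed.

(** Only the second variable is changed, so the difference quotient in x at (x, y) is that of [F] at
    (x, T y). This allows a [T] that is only piecewise linear, or constant. *)
Lemma C1x_comp_y F DF (T : R -> R) : {within `[0, 1], continuous T} ->
  (forall y, 0 <= y <= 1 -> 0 <= T y <= 1) -> C1x F DF ->
  C1x (fun p => F (p.1, T p.2)) (fun p => DF (p.1, T p.2)).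
Proof.
move=> /subspace_continuousP cT T01 [cF cDF dF].
have H G : {within unit_square, continuous G} ->
   {within unit_square, continuous (fun p => G (p.1, T p.2))}.
  move=> /subspace_continuousP cG; apply/subspace_continuousP => -[x y] [Mx My].
  have My' := My; rewrite /= in_itv /= in My'.
  have cg := cG (x, T y); apply: cvg_comp (cg _); last first.
    by split => //=; rewrite in_itv /= T01.
  move=> P HP; have /nbhs_ballP[e /= e0 eP] :
    nbhs (x, T y) (fun q => unit_square q -> P q) := HP.
  have /nbhs_ballP[d /= d0 dP] :
    nbhs y (fun z => z \in `[0, 1] -> ball (T y) e (T z)) :=
    cT y My _ (nbhsx_ballx _ _ e0).
  apply/nbhs_ballP; exists (Num.min d e); first by rewrite /= lt_min d0 e0.
  move=> [x' y'] [/= xx' yy'] /unit_squareP[Mx' My'2]; apply: eP.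
    split => /=; first by apply: le_ball xx'; rewrite ge_min lexx orbT.
    by apply: dP; [apply: le_ball yy'; rewrite ge_min lexx|rewrite in_itv].
  by apply/unit_squareP; split => //; exact: T01.
split; [exact: H|exact: H|] => -[x y] /unit_squareP[Mx My].
by have := dF (x, T y); apply; apply/unit_squareP; split => //; exact: T01.
Qed.

Lemma partial_xE F p (d : R) : unit_square p -> diff_quot_x F p @ incr_x p --> d ->
  partial_x F p = d.
Proof. by move=> Mp; have := incr_x_proper _ Mp => ? /cvg_lim; apply. Qed.

End C1x.

(** * Compactness of the square and uniform continuity *)

Section continuity.
Context {R : realType}.
Implicit Types F : R * R -> R.

Lemma within_continuous_dist {T : pseudoMetricType R} (A : set T) (f : T -> R) x :
  {within A, continuous f} -> A x -> forall e, 0 < e ->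
  exists2 d, 0 < d & forall z, A z -> ball x d z -> `|f x - f z| < e.
Proof.
move=> /subspace_continuousP cf Ax e e0.
have /nbhs_ballP[d /= d0 dP] : nbhs x (fun z => A z -> ball (f x) e (f z)) :=
  cf x Ax _ (nbhsx_ballx _ _ e0).
by exists d => // z Az xz; exact: dP.
Qed.

Lemma compact_unit_square : compact (unit_square : set (R * R)).
Proof. by apply: compact_setX; exact: segment_compact. Qed.

Lemma unit_square_bounded F : {within unit_square, continuous F} ->
  exists2 M, 0 < M & forall p, unit_square p -> `|F p| <= M.
Proof.
move=> cF; have := continuous_compact cF compact_unit_square.
move=> /compact_bounded[M [_ MP]]; exists (`|M| + 1); first by rewrite ltr_wpDl.
move=> p Mp; apply: (MP (`|M| + 1)); last by exists p.
by rewrite (le_lt_trans (ler_norm M)) // ltrDl.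
Qed.

(** Heine-Cantor, from the near-covering form of compactness: the radius [d] tends to 0 from the
    right, and half of the radius of continuity at [p] is kept for the triangle inequality. *)
Lemma unit_square_unif_continuous F : {within unit_square, continuous F} ->
  forall e, 0 < e -> exists2 d, 0 < d & forall x x' y y' : R,
    unit_square (x, y) -> unit_square (x', y') ->
    `|x - x'| < d -> `|y - y'| < d -> `|F (x, y) - F (x', y')| < e.
Proof.
move=> cF e e0.
have /compact_near_coveringP/near_covering_withinP cov := compact_unit_square.
have H := cov R 0^'+ (fun d p => forall q, unit_square q ->
    ball p d q -> `|F p - F q| < e) _.
have {H} : \forall d \near 0^'+, unit_square `<=` (fun p => forall q,
    unit_square q -> ball p d q -> `|F p - F q| < e).
  apply: H.
  move=> p Mp; have e2 : 0 < e / 2 by rewrite divr_gt0.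
  have [r r0 rP] := within_continuous_dist _ _ _ cF Mp _ e2.
  have r2 : 0 < r / 2 by rewrite divr_gt0.
  exists (ball p (r / 2), [set d | d < r / 2]).
    by split => /=; [exact: nbhsx_ballx|exact: nbhs_right_lt].
  move=> [p' d] /= [pp' dr] Mp' q Mq pq.
  have h1 : `|F p - F p'| < e / 2.
    by apply: rP => //; apply: le_ball pp'; rewrite ler_pdivrMr // ler_peMr ?ler1n // ltW.
  have h2 : `|F p - F q| < e / 2.
    apply: rP => //; rewrite [r]splitr; apply: ball_triangle pp' _.
    by apply: le_ball pq; exact: ltW.
  rewrite [e]splitr -(subrKA (F p)) (le_lt_trans (ler_normD _ _)) // distrC.
  by rewrite ltrD.
move=> /(filterI (nbhs_right_gt 0)) /filter_ex [d [d0 dP]].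
exists d => // x x' y y' Mp Mq xd yd; exact: dP.
Qed.

End continuity.

Section powR.
Context {R : realType}.

Lemma powR_small (C b e : R) : 0 < C -> 0 < b -> 0 < e ->
  exists2 d, 0 < d & forall t, 0 <= t <= d -> C * t `^ b <= e.
Proof.
move=> C0 b0 e0; exists ((e / C) `^ b^-1); first by rewrite powR_gt0 // divr_gt0.
move=> t /andP[t0 td]; rewrite mulrC -ler_pdivlMr //.
have -> : e / C = ((e / C) `^ b^-1) `^ b.
  by rewrite -powRrM mulVf ?gt_eqF // powRr1 // ltW // divr_gt0.
by apply: ge0_ler_powR; rewrite ?nnegrE ?powR_ge0 // ltW.
Qed.

End powR.

(** * Monotonicity and continuity from the bi-Hoelder bounds *)

Section bihol_facts.
Context {R : realType} {C beta alpha : R}.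
Hypotheses (C1 : 1 < C) (b0 : 0 < beta).
Implicit Type f : bihol_space C beta alpha.

Let C0 : 0 < C. Proof. exact: lt_trans ltr01 C1. Qed.

Lemma bihol_continuous_y f x : 0 <= x <= 1 ->
  {within `[0, 1], continuous (fun y => f (x, y))}.
Proof.
move=> x01; apply/subspace_continuousP => y; rewrite /= => y01.
apply/cvgrPdist_le => e e0; have [d d0 dP] := powR_small _ _ _ C0 b0 e0.
apply/nbhs_ballP; exists d => //= z /= yz z01; have [->|zy] := eqVneq z y.
  by rewrite subrr normr0 ltW.
have /andP[_ /le_trans] := bihol_bi_holder f (x01 : x \in `[0, 1]) z01 y01 zy.
by apply; apply: dP; rewrite normr_ge0 ltW.
Qed.

Lemma bihol_incr f x y1 y2 : 0 <= x <= 1 -> 0 <= y1 -> y1 < y2 -> y2 <= 1 ->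
  C^-1 * (y2 - y1) `^ beta^-1 <= f (x, y2) - f (x, y1) <= C * (y2 - y1) `^ beta.
Proof.
move=> x01 y10 y12 y21.
have I1 : y1 \in `[0, 1] by rewrite in_itv /= y10 (ltW (lt_le_trans y12 y21)).
have I2 : y2 \in `[0, 1] by rewrite in_itv /= y21 (ltW (le_lt_trans y10 y12)).
have [x0I y0I] : x \in `[0, 1] /\ (0 : R) \in `[0, 1].
  by rewrite !in_itv /= lexx ler01.
have inj : {in `[0, 1] &, injective (fun y => f (x, y))}.
  move=> y y' Iy Iy' /= ff; apply/eqP; apply: contraTT isT => yy'.
  have := bihol_bi_holder f x0I Iy Iy' yy'; rewrite ff subrr normr0 => /andP[+ _].
  by rewrite leNgt mulr_gt0 ?invr_gt0 // powR_gt0 // normr_gt0 subr_eq0 eq_sym.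
have f01 : f (x, 0) <= f (x, 1) by rewrite bihol_bot // bihol_top // ler01.
have mono := segment_continuous_inj_le f01 (bihol_continuous_y f x x01) inj.
have f12 : f (x, y1) <= f (x, y2) by rewrite (mono y1 y2 I1 I2) ltW.
have := bihol_bi_holder f x0I I1 I2; rewrite lt_eqF // => /(_ isT).
by rewrite !ger0_norm // subr_ge0 // ltW.
Qed.

End bihol_facts.

Section C1x_bihol.
Context {R : realType} {C beta alpha : R}.
Hypotheses (C1 : 1 < C) (b0 : 0 < beta).
Implicit Type f : bihol_space C beta alpha.

Let C0 : 0 < C. Proof. exact: lt_trans ltr01 C1. Qed.

(** Differentiability in x controls the horizontal move from (x0, y0) to (x, y0); the Hoelder bound,
    which is uniform in x, controls the vertical move from there to (x, y). *)
Lemma bihol_continuous f : {within unit_square, continuous f}.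
Proof.
apply/subspace_continuousP => -[x0 y0] /[dup] Mp /unit_squareP[x001 y001].
apply/cvgrPdist_lt => e e0; have e4 : 0 < e / 4 by rewrite divr_gt0.
have [d d0 dP] := powR_small _ _ _ C0 b0 e4.
have df : diff_quot_x f (x0, y0) @ incr_x (x0, y0) --> partial_x f (x0, y0).
  by have := (bihol_C1 f).1 _ Mp.
have id0 : h @[h --> incr_x (x0, y0)] --> (0 : R).
  exact: cvg_trans (cvg_within _) (@cvg_within _ _ _ _).
have e2 : 0 < e / 2 by rewrite divr_gt0.
(* The increment of [f] is [h] times its difference quotient, hence tends to 0. *)
have hd0 : h * diff_quot_x f (x0, y0) h @[h --> incr_x (x0, y0)] -->
    0 * partial_x f (x0, y0) by exact: cvgM id0 df.
have /nbhs_ballP[r /= r0 rP] : nbhs (0 : R) (fun h => h != 0 ->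
    x0 + h \in `[0, 1] -> ball (0 * partial_x f (x0, y0)) (e / 2)
      (h * diff_quot_x f (x0, y0) h)) := hd0 _ (nbhsx_ballx _ _ e2).
apply/nbhs_ballP; exists (Num.min d r); first by rewrite /= lt_min d0.
move=> [x y] [/= xx yy] /unit_squareP[x01 y01].
have fx : `|f (x0, y0) - f (x, y0)| < e / 2.
  have [->|xx0] := eqVneq x x0; first by rewrite subrr normr0 divr_gt0.
  have h0 : x - x0 != 0 by rewrite subr_eq0.
  have hr : ball 0 r (x - x0).
    by move: xx; rewrite /ball /= sub0r normrN distrC lt_min => /andP[].
  have hI : x0 + (x - x0) \in `[0, 1] by rewrite addrC subrK.
  have := rP _ hr h0 hI; rewrite /ball /= mul0r sub0r normrN /diff_quot_x /=.
  by rewrite mulrA mulfV // mul1r [x0 + _]addrC subrK distrC.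
have fy : `|f (x, y0) - f (x, y)| <= e / 4.
  have [->|yy0] := eqVneq y y0; first by rewrite subrr normr0 ltW.
  have /andP[_ /le_trans] := bihol_bi_holder f (x01 : x \in `[0, 1])
    (y01 : y \in `[0, 1]) (y001 : y0 \in `[0, 1]) yy0.
  apply; apply: dP; rewrite normr_ge0 /= ltW //.
  by move: yy; rewrite /ball /= lt_min => /andP[].
rewrite -(subrKA (f (x, y0))) (le_lt_trans (ler_normD _ _)) //.
by lra.
Qed.

Lemma bihol_C1x f : C1x f (partial_x f).
Proof.
split; [exact: bihol_continuous|exact: (bihol_C1 f).2|].
by move=> p Mp; have := (bihol_C1 f).1 _ Mp.
Qed.

End C1x_bihol.

(** * Construction of elements of the function space *)

Section constructor.
Context {R : realType} {C beta : R} (alpha : R).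

(** Replacing [F] by 0 off the square leaves the x-derivative unchanged, since the increments of
    [incr_x] never leave the square. *)
Lemma bihol_exists (F DF : R * R -> R) : 0 < C -> 0 < beta -> C1x F DF ->
  (forall y : R, 0 <= y <= 1 -> F (0, y) = y) ->
  (forall x : R, 0 <= x <= 1 -> F (x, 0) = 0) ->
  (forall x : R, 0 <= x <= 1 -> F (x, 1) = 1) ->
  (forall x y1 y2, 0 <= x <= 1 -> 0 <= y1 -> y1 < y2 -> y2 <= 1 ->
    C^-1 * (y2 - y1) `^ beta^-1 <= F (x, y2) - F (x, y1) <= C * (y2 - y1) `^ beta) ->
  exists g : bihol_space C beta alpha, forall p, unit_square p ->
    g p = F p /\ partial_x g p = DF p.
Proof.
move=> C0 b0 [cF cDF dF] Fleft Fbot Ftop FH.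
pose G p := if p \in unit_square then F p else 0.
have GE p : unit_square p -> G p = F p by move=> Mp; rewrite /G mem_set.
have dG p : unit_square p -> diff_quot_x G p @ incr_x p --> DF p.
  move=> Mp; apply: cvg_trans (dF _ Mp).
  apply: fmap_within_eq => h; rewrite inE /= => xh.
  rewrite /diff_quot_x !GE //.
  by case: p Mp xh => x y /unit_squareP[_ y01] /= xh; apply/unit_squareP.
have pG p : unit_square p -> partial_x G p = DF p.
  by move=> Mp; exact: partial_xE (dG _ Mp).
have G_out p : ~ unit_square p -> G p = 0 by move=> Mp; rewrite /G memNset.
have G_C1 : C1_in_x G.
  split; first by move=> p Mp; apply/cvg_ex; exists (DF p); exact: dG.
  apply: (@subspace_eq_continuous _ _ _ DF) => //.
  by move=> p /set_mem Mp; apply/esym/pG.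
have [I0 I1] : 0 <= (0 : R) <= 1 /\ 0 <= (1 : R) <= 1 by rewrite !lexx ler01.
have G_left y : y \in `[0, 1] -> G (0, y) = y.
  by rewrite in_itv => y01; rewrite GE ?Fleft //; apply/unit_squareP.
have G_bot x : x \in `[0, 1] -> G (x, 0) = 0.
  by rewrite in_itv => y01; rewrite GE ?Fbot //; apply/unit_squareP.
have G_top x : x \in `[0, 1] -> G (x, 1) = 1.
  by rewrite in_itv => y01; rewrite GE ?Ftop //; apply/unit_squareP.
have G_H : bi_holder C beta G.
  move=> x y1 y2; rewrite !in_itv /= => x01 y1I y2I y12.
  rewrite !GE; try exact/unit_squareP.
  wlog : y1 y2 y1I y2I y12 / y1 < y2 => [H|ylt].
    have [y12'|y21'|/eqP] := ltgtP y1 y2; last by rewrite (negbTE y12).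
      exact: H.
    by rewrite distrC [X in _ <= X <= _]distrC; apply: H; rewrite // eq_sym.
  have /andP[y10 _] := y1I; have /andP[_ y21] := y2I.
  have h := FH _ _ _ x01 y10 ylt y21.
  rewrite !ger0_norm // ?subr_ge0 ?ltW // -subr_gt0.
  have /andP[+ _] := h; apply: lt_le_trans.
  by rewrite mulr_gt0 ?invr_gt0 // powR_gt0 // subr_gt0.
by exists (@BiholSpace _ _ _ alpha _ G_out G_C1 G_left G_bot G_top G_H) => p Mp /=; rewrite GE // pG.
Qed.

End constructor.

(** * The metric d_alpha *)

Section holder_interpolation.
Context {R : realType} (alpha beta : R).
Hypotheses (a0 : 0 <= alpha) (ab : alpha < beta).

(** Write an increment X of [u] as X^t X^(1 - t) with t = alpha / beta: the first factor is bounded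
    by the beta-Hoelder estimate, the second by the sup bound. As t < 1, the result tends to 0 with
    [d]. *)
Lemma holder_norm_interpolation (K d : R) (u : R -> R) : 0 <= K -> 0 <= d ->
  (forall y, 0 <= y <= 1 -> `|u y| <= d) ->
  (forall y1 y2, 0 <= y1 <= 1 -> 0 <= y2 <= 1 -> y1 != y2 ->
    `|u y2 - u y1| <= K * `|y2 - y1| `^ beta) ->
  (holder_norm alpha u <=
    (K `^ (alpha / beta) * (2 * d) `^ (1 - alpha / beta))%:E)%E.
Proof.
move=> K0 d0 ud uK; have b0 : 0 < beta by exact: le_lt_trans ab.
set t := alpha / beta.
have t0 : 0 <= t by rewrite divr_ge0 // ltW.
have t1 : 0 < 1 - t by rewrite subr_gt0 ltr_pdivrMr // mul1r.
apply: ge_ereal_sup => _ [y1 [y2 [y1I y2I y12 ->]]].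
have {}y1I : 0 <= y1 <= 1 by rewrite in_itv in y1I.
have {}y2I : 0 <= y2 <= 1 by rewrite in_itv in y2I.
have y21 : 0 < `|y2 - y1| by rewrite normr_gt0 subr_eq0 eq_sym.
rewrite lee_fin ler_pdivrMr ?powR_gt0 //.
set X := `|u y2 - u y1|; have X0 : 0 <= X by exact: normr_ge0.
have -> : X = X `^ t * X `^ (1 - t).
  by rewrite -powRD addrC subrK ?powRr1 // oner_eq0.
have h1 : X `^ t <= K `^ t * `|y2 - y1| `^ alpha.
  have -> : alpha = beta * t by rewrite /t mulrC divfK // gt_eqF.
  rewrite powRrM -powRM ?powR_ge0 //; apply: ge0_ler_powR => //.
    by rewrite nnegrE mulr_ge0 // powR_ge0.
  exact: uK.
have h2 : X `^ (1 - t) <= (2 * d) `^ (1 - t).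
  apply: ge0_ler_powR; rewrite ?nnegrE ?mulr_ge0 //; first exact: ltW.
  by rewrite (le_trans (ler_normB _ _)) // mulr_natl mulr2n lerD // ud.
by rewrite mulrAC; apply: ler_pM; rewrite ?powR_ge0.
Qed.

End holder_interpolation.

Section dist_alpha_small.
Context {R : realType} {C beta alpha : R}.
Hypotheses (C1 : 1 < C) (a0 : 0 <= alpha) (ab : alpha < beta) (b1 : beta < 1).
Implicit Types f g : bihol_space C beta alpha.

Let C0 : 0 < C. Proof. exact: lt_trans ltr01 C1. Qed.
Let b0 : 0 < beta. Proof. exact: le_lt_trans ab. Qed.

(** The intermediate value theorem makes f (x, .) surjective onto [0, 1], so the pseudo-inverse
    defining [holonomyx0] is a genuine right inverse there. *)
Lemma holonomyx0_inv f x z : 0 <= x <= 1 -> 0 <= z <= 1 ->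
  0 <= holonomyx0 f x z <= 1 /\ f (x, holonomyx0 f x z) = z.
Proof.
move=> x01 z01.
have f01 : holonomy0x f x 0 <= holonomy0x f x 1.
  by rewrite /holonomy0x bihol_bot // bihol_top // ler01.
have := segment_continuous_le_surjective ler01 f01 (bihol_continuous_y C1 b0 f x x01).
rewrite /holonomy0x bihol_bot // bihol_top // => srj.
have zI : z \in `[0, 1]%classic by rewrite inE /= in_itv.
split; last by exact: (surjpK (fun=> 0) srj zI).
have : `[0, 1]%classic (holonomyx0 f x z).
  apply: (surjpinv_image_sub srj); exists z => //; exact: set_mem.
by rewrite /= in_itv.
Qed.

(** The lower Hoelder bound solved for the distance of the arguments: the inverse holonomies are
    beta-Hoelder with constant C^beta. *)
Lemma bihol_dist_le f x y1 y2 : 0 <= x <= 1 -> 0 <= y1 <= 1 -> 0 <= y2 <= 1 ->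
  `|y2 - y1| <= (C * `|f (x, y2) - f (x, y1)|) `^ beta.
Proof.
move=> x01 y1I y2I; have [->|y12] := eqVneq y1 y2.
  by rewrite subrr normr0 powR_ge0.
have /andP[+ _] := bihol_bi_holder f (x01 : x \in `[0, 1])
    (y1I : y1 \in `[0, 1]) (y2I : y2 \in `[0, 1]) y12.
rewrite mulrC ler_pdivrMr // mulrC => h.
rewrite -[leLHS]powRr1 // -{1}(mulVf (lt0r_neq0 b0)) powRrM.
apply: ge0_ler_powR h; rewrite ?nnegrE ?powR_ge0 //; first exact: ltW.
by rewrite mulr_ge0 // ltW.
Qed.

(** The holonomies and their inverses share the beta-Hoelder constant [C], so their differences have
    constant 2 C, and interpolation reduces the alpha-norms to sup distances. *)
Lemma dist_alpha_small (e : R) : 0 < e -> exists2 d, 0 < d & forall f g,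
  (forall p, unit_square p -> `|f p - g p| <= d) ->
  (forall p, unit_square p -> `|partial_x f p - partial_x g p| <= d) ->
  (dist_alpha alpha f g < e%:E)%E.
Proof.
move=> e0; set t := alpha / beta.
have t1 : 0 < 1 - t by rewrite subr_gt0 ltr_pdivrMr // mul1r.
have K0 : 0 < 2 * C by rewrite mulr_gt0.
have e4 : 0 < e / 4 by rewrite divr_gt0.
have [d1 d10 d1P] := powR_small _ _ _ (powR_gt0 t K0) t1 e4.
have d12 : 0 < d1 / 2 by rewrite divr_gt0.
have [d2 d20 d2P] := powR_small _ _ _ ltr01 b0 d12.
(* A sup distance of [d1 / 2] makes an interpolated norm at most e / 4; [d2 / C] brings the inverse
   holonomies that close, because (C d)^beta <= d1 / 2; [e / 4] serves each C^0 norm. *)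
pose d := Num.min (d1 / 2) (Num.min (d2 / C) (e / 4)).
have d0 : 0 < d by rewrite !lt_min d12 e4 divr_gt0.
have dd1 : d <= d1 / 2 by rewrite ge_min lexx.
have dd2 : d <= d2 / C by rewrite ge_min orbC ge_min lexx.
have dde : d <= e / 4 by rewrite !ge_min lexx !orbT.
exists d => // f g fg Dfg.
have norm_le (u : R * R -> R) : (forall p, unit_square p -> `|u p| <= d) ->
    (C0_norm u <= (e / 4)%:E)%E.
  move=> ud; apply: ge_ereal_sup => _ [p Mp <-].
  by rewrite lee_fin (le_trans _ dde) // ud.
have holder_le (u : R -> R) : (forall y, 0 <= y <= 1 -> `|u y| <= d1 / 2) ->
    (forall y1 y2, 0 <= y1 <= 1 -> 0 <= y2 <= 1 -> y1 != y2 ->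
      `|u y2 - u y1| <= (2 * C) * `|y2 - y1| `^ beta) ->
    (holder_norm alpha u <= (e / 4)%:E)%E.
  move=> ud uK.
  apply: le_trans (holder_norm_interpolation _ _ a0 ab _ _ _ (ltW K0) (ltW d12) ud uK) _.
  rewrite lee_fin; apply: d1P.
  by rewrite mulrC divfK ?lexx ?ltW // gt_eqF.
have two_C (a b r : R) : `|a| <= C * r -> `|b| <= C * r -> `|a - b| <= 2 * C * r.
  move=> ar br; rewrite (le_trans (ler_normB _ _)) //.
  by rewrite -mulrA mulr_natl mulr2n lerD.
apply: le_lt_trans (_ : (_ <= (e / 4 + e / 4 + e / 4)%:E)%E) _; last first.
  by rewrite lte_fin; lra.
rewrite !EFinD; apply: leeD; first by apply: leeD; exact: norm_le.
apply: ge_ereal_sup => _ [] [x x01 <-]; apply: holder_le.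
- move=> y y01; rewrite /holonomy0x /= (le_trans _ dd1) //; apply: fg.
  exact/unit_squareP.
- move=> y1 y2 y1I y2I y12; rewrite /holonomy0x /=.
  have /andP[_ hf] := bihol_bi_holder f x01 y1I y2I y12.
  have /andP[_ hg] := bihol_bi_holder g x01 y1I y2I y12.
  have -> : f (x, y2) - g (x, y2) - (f (x, y1) - g (x, y1)) =
    (f (x, y2) - f (x, y1)) - (g (x, y2) - g (x, y1)) by ring.
  exact: two_C.
- move=> z z01; have [yf01 fyf] := holonomyx0_inv f x z x01 z01.
  have [yg01 gyg] := holonomyx0_inv g x z x01 z01; rewrite /=.
  (* Both preimages of [z] are compared through [f]: the value of [f] at the first and of [g] at the
     second is [z], so their distance is controlled by f - g at the second. *)
  rewrite (le_trans (bihol_dist_le _ _ _ _ x01 yg01 yf01 : _ <= (C * `|f _ - f _|) `^ _)) //.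
  rewrite fyf -{1}gyg distrC.
  have := d2P (C * `|f (x, holonomyx0 g x z) - g (x, holonomyx0 g x z)|).
  rewrite mul1r; apply; rewrite mulr_ge0 ?(ltW C0) //= mulrC -ler_pdivlMr //.
  rewrite (le_trans _ dd2) //; apply: fg; exact/unit_squareP.
- move=> z1 z2 z1I z2I z12 /=.
  set f1 := holonomyx0 f x z1; set f2 := holonomyx0 f x z2.
  set g1 := holonomyx0 g x z1; set g2 := holonomyx0 g x z2.
  have -> : f2 - g2 - (f1 - g1) = (f2 - f1) - (g2 - g1) by ring.
  have C_le (h : bihol_space C beta alpha) :
      `|holonomyx0 h x z2 - holonomyx0 h x z1| <= C * `|z2 - z1| `^ beta.
    have [h1I hz1] := holonomyx0_inv h x z1 x01 z1I.
    have [h2I hz2] := holonomyx0_inv h x z2 x01 z2I.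
    rewrite (le_trans (bihol_dist_le h _ _ _ x01 h1I h2I)) // hz1 hz2.
    (* C^beta <= C because C > 1 and beta < 1. *)
    rewrite powRM ?(ltW C0) // ler_wpM2r ?powR_ge0 //.
    by rewrite -[leRHS]powRr1 ?(ltW C0) // ler_powR // ltW.
  exact: two_C (C_le f) (C_le g).
Qed.

End dist_alpha_small.

(** * Piecewise linear interpolation *)

Section powR_convexity.
Context {R : realType}.
Implicit Types (p b s t l : R).

Lemma powR_convex p s t l : 1 <= p -> 0 <= s -> 0 <= t -> 0 <= l <= 1 ->
  ((1 - l) * s + l * t) `^ p <= (1 - l) * s `^ p + l * t `^ p.
Proof.
move=> p1 s0 t0 /andP[l0 l1].
have := @convex_powR R p p1 (Itv01 l0 l1) t s.
rewrite !inE /= !in_itv /= !andbT => /(_ t0 s0).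
by move=> h; rewrite addrC [leRHS]addrC; exact: h.
Qed.

(** Convexity of the power 1/b, applied to s^b and t^b, and then raised to the power [b]. *)
Lemma powR_concave b s t l : 0 < b <= 1 -> 0 <= s -> 0 <= t -> 0 <= l <= 1 ->
  (1 - l) * s `^ b + l * t `^ b <= ((1 - l) * s + l * t) `^ b.
Proof.
move=> /andP[b0 b1] s0 t0 /[dup] l01 /andP[l0 l1].
set S := (X in X <= _).
have S0 : 0 <= S by rewrite addr_ge0 // mulr_ge0 ?powR_ge0 // subr_ge0.
have -> : S = (S `^ b^-1) `^ b by rewrite -powRrM mulVf ?gt_eqF // powRr1.
have b1V : 1 <= b^-1 by rewrite invf_ge1.
apply: ge0_ler_powR; rewrite ?nnegrE ?powR_ge0 ?(ltW b0) //.
  by rewrite addr_ge0 // mulr_ge0 // subr_ge0.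
have := powR_convex _ _ _ _ b1V (powR_ge0 s b) (powR_ge0 t b) l01.
by rewrite -!powRrM mulfV ?gt_eqF // !powRr1.
Qed.

End powR_convexity.

Section piecewise_linear.
Context {R : realType}.
Implicit Types (a : nat -> R) (y u : R).

(** The tent of height 1 at j/N that vanishes beyond distance 1/N; the positive part is written with
    an absolute value, so that its continuity is immediate. *)
Definition hat (N j : nat) y : R :=
  let t := 1 - `|N%:R * y - j%:R| in (t + `|t|) / 2.

Lemma hat_continuous N j : continuous (hat N j).
Proof.
move=> y; rewrite /hat; apply: cvgM; last exact: cvg_cst.
have ct : (1 - `|N%:R * z - j%:R|) @[z --> y] --> 1 - `|N%:R * y - j%:R|.
  apply: cvgB; first exact: cvg_cst.
  apply: cvg_norm; apply: cvgB; last exact: cvg_cst.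
  by apply: cvgM; [exact: cvg_cst|exact: cvg_id].
by apply: cvgD => //; exact: cvg_norm.
Qed.

Definition interp (N : nat) a y : R := \sum_(j < N.+1) a j * hat N j y.

Lemma unit_itv_cell (N : nat) y : (0 < N)%N -> 0 <= y <= 1 ->
  exists i u, [/\ (i < N)%N, 0 <= u <= 1 & y = (i%:R + u) / N%:R].
Proof.
move=> N0 /andP[y0 y1]; have q0 : 0 < N%:R :> R by rewrite ltr0n.
have [yN|yN] := eqVneq y 1.
  (* At y = 1 the truncation of N y would be [N], which is out of range; the last cell with u = 1 is
     taken instead. *)
  exists N.-1, 1; rewrite prednK // leqnn lexx ler01; split => //.
  by rewrite yN natr1 prednK // divff // gt_eqF.
have Ny0 : 0 <= N%:R * y by rewrite mulr_ge0.
exists (Num.truncn (N%:R * y)), (N%:R * y - (Num.truncn (N%:R * y))%:R).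
have /andP[h1 h2] := truncn_itv Ny0.
split.
- rewrite -(ltr_nat R) (le_lt_trans h1) // gtr_pMr // lt_neqAle yN //.
- by rewrite subr_ge0 h1 lerBlDl ltW //= natr1 .
- by rewrite addrC subrK mulrC mulKf // gt_eqF.
Qed.

(** On a cell only the tents at its two ends can be nonzero, with values 1 - u and u. *)
Lemma interp_cell (N i : nat) a u : (i < N)%N -> 0 <= u <= 1 ->
  interp N a ((i%:R + u) / N%:R) = (1 - u) * a i + u * a i.+1.
Proof.
move=> iN /andP[u0 u1].
have q0 : N%:R != 0 :> R by rewrite pnatr_eq0 -lt0n (leq_ltn_trans _ iN).
rewrite /interp /hat mulrC divfK //.
have iN1 : (i < N.+1)%N by rewrite ltnW.
rewrite (bigD1 (Ordinal iN1)) //= (bigD1 (Ordinal (iN : i.+1 < N.+1)%N)) /=; last first.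
  by rewrite -val_eqE /= eq_sym ltn_eqF.
rewrite big1 ?addr0; last first.
  move=> [j jN] /andP[]; rewrite -!val_eqE /= => ji ji1.
  set t := 1 - _; suff t0 : t <= 0 by rewrite ler0_norm // subrr mul0r mulr0.
  rewrite subr_le0; have [jlt|jgt] := ltnP j i.
    have : j.+1%:R <= i%:R :> R by rewrite ler_nat.
    rewrite -natr1 => h; rewrite ger0_norm; lra.
  have : i.+2%:R <= j%:R :> R.
    by rewrite ler_nat ltn_neqAle eq_sym ji1 ltn_neqAle eq_sym ji.
  rewrite -!natr1 => h; rewrite ler0_norm; lra.
have -> : i%:R + u - i%:R = u by ring.
have -> : i%:R + u - i.+1%:R = u - 1 by rewrite -natr1; ring.
rewrite [`|u|]ger0_norm // [`|u - 1|]ler0_norm ?subr_le0 //.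
rewrite !ger0_norm ?subr_ge0 //; last by rewrite opprB; lra.
by field.
Qed.

(* The extreme points of a product of two cells are pairs of nodes, so Jensen's
   inequality transfers a concave modulus of continuity from the nodes. *)
Lemma interp_modulus (N : nat) a (om : R -> R) : (0 < N)%N ->
  (forall s t l, 0 <= s -> 0 <= t -> 0 <= l <= 1 ->
    (1 - l) * om s + l * om t <= om ((1 - l) * s + l * t)) ->
  om 0 = 0 ->
  (forall i j, (i < j)%N -> (j <= N)%N -> a j - a i <= om ((j%:R - i%:R) / N%:R)) ->
  forall y1 y2, 0 <= y1 -> y1 < y2 -> y2 <= 1 ->
  interp N a y2 - interp N a y1 <= om (y2 - y1).
Proof.
move=> N0 om_conc om0 a_om y1 y2 y10 y12 y21.
have q0 : 0 < N%:R :> R by rewrite ltr0n.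
have qV0 : 0 < N%:R^-1 :> R by rewrite invr_gt0.
have y1I : 0 <= y1 <= 1 by rewrite y10 (ltW (lt_le_trans y12 y21)).
have y2I : 0 <= y2 <= 1 by rewrite y21 (ltW (le_lt_trans y10 y12)).
have {}a_om i j : (i <= j)%N -> (j <= N)%N -> a j - a i <= om ((j%:R - i%:R) / N%:R).
  rewrite leq_eqVlt => /predU1P[->|]; last exact: a_om.
  by rewrite !subrr mul0r om0.
have [i [u [iN u01 y1E]]] := unit_itv_cell N y1 N0 y1I.
have [j [t [jN t01 y2E]]] := unit_itv_cell N y2 N0 y2I.
have [u0 u1] := andP u01; have [t0 t1] := andP t01.
have uC : 0 <= 1 - u by rewrite subr_ge0.
have tC : 0 <= 1 - t by rewrite subr_ge0.
have p1 : interp N a y1 = (1 - u) * a i + u * a i.+1 by rewrite y1E interp_cell.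
have p2 : interp N a y2 = (1 - t) * a j + t * a j.+1 by rewrite y2E interp_cell.
have natB (k l : nat) : (k <= l)%N -> 0 <= (l%:R - k%:R) / N%:R :> R.
  by move=> kl; rewrite divr_ge0 // subr_ge0 ler_nat.
have [ij|ij|ij] := ltngtP i j.
(* Different cells: concavity is used first in [y2], with the other end at a node, then in [y1]
   between the two nodes of its cell. *)
- have node k : (k <= j)%N -> interp N a y2 - a k <= om (y2 - k%:R / N%:R).
    move=> kj; have -> : interp N a y2 - a k = (1 - t) * (a j - a k) + t * (a j.+1 - a k).
      by rewrite p2; ring.
    have -> : y2 - k%:R / N%:R = (1 - t) * ((j%:R - k%:R) / N%:R) +
                                 t * ((j.+1%:R - k%:R) / N%:R).
      by rewrite y2E -natr1; ring.
    apply: le_trans (om_conc _ _ _ (natB _ _ kj) (natB _ _ (leqW kj)) t01).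
    by apply: lerD; apply: ler_wpM2l => //; apply: a_om => //; [exact: ltnW|exact: leqW].
  have -> : interp N a y2 - interp N a y1 =
      (1 - u) * (interp N a y2 - a i) + u * (interp N a y2 - a i.+1).
    by rewrite p1; ring.
  have -> : y2 - y1 = (1 - u) * (y2 - i%:R / N%:R) + u * (y2 - i.+1%:R / N%:R).
    by rewrite y1E -natr1; ring.
  have ge0 k : (k <= j)%N -> 0 <= y2 - k%:R / N%:R.
    by move=> kj; rewrite y2E -mulrBl divr_ge0 // addrAC addr_ge0 // subr_ge0 ler_nat.
  apply: le_trans (om_conc _ _ _ (ge0 _ (ltnW ij)) (ge0 _ ij) u01).
  by apply: lerD; apply: ler_wpM2l => //; apply: node => //; exact: ltnW.
- suff : y2 <= y1 by rewrite leNgt y12.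
  rewrite y1E y2E ler_pM2r //.
  have : j.+1%:R <= i%:R :> R by rewrite ler_nat.
  by rewrite -natr1; lra.
(* Same cell: the increment is the fraction t - u of the increment between adjacent nodes, and
   concavity is used between the lengths 0 and 1/N, with [om] vanishing at 0. *)
- subst j; have ut : u < t by move: y12; rewrite y1E y2E ltr_pM2r // ltrD2l.
  have -> : interp N a y2 - interp N a y1 = (t - u) * (a i.+1 - a i).
    by rewrite p1 p2; ring.
  have -> : y2 - y1 = (1 - (t - u)) * 0 + (t - u) * ((i.+1%:R - i%:R) / N%:R).
    by rewrite y1E y2E -natr1; ring.
  have tu : 0 <= t - u <= 1 by apply/andP; split; lra.
  apply: le_trans (om_conc _ _ _ (lexx 0) (natB _ _ (leqnSn i)) tu).
  rewrite om0 mulr0 add0r; apply: ler_wpM2l; first by case/andP: tu.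
  by apply: a_om.
Qed.

End piecewise_linear.

(** * Periodic expansions and C^1 steps *)

Section periodic_expansion.
Context {R : realType} (e : R).
Hypothesis e01 : 0 < e < 1.
Implicit Types (u y z : R) (N : nat).

Let e0 : 0 < e. Proof. by case/andP: e01. Qed.
Let e1 : e < 1. Proof. by case/andP: e01. Qed.

(** A convex combination of the identity with the map that expands [0, e] onto [0, 1] and collapses
    [e, 1]; the identity keeps the slope at least [e]. *)
Definition cell_map u : R := e * u + (1 - e) * Num.min (u / e) 1.

Lemma cell_map0 : cell_map 0 = 0.
Proof. by rewrite /cell_map mul0r min_l ?ler01 // !mulr0 addr0. Qed.

Lemma cell_map1 : cell_map 1 = 1.
Proof. by rewrite /cell_map mul1r min_r ?invf_ge1 ?ltW //; ring. Qed.

Lemma cell_map_e : 1 - e <= cell_map e <= 1.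
Proof.
have -> : cell_map e = 1 - e * (1 - e).
  by rewrite /cell_map divff ?gt_eqF // minxx; ring.
have : 0 <= e * (1 - e) <= e.
  by rewrite mulr_ge0 ?subr_ge0 ?(ltW e0) ?(ltW e1) //= ger_pMr // gerBl ltW.
by lra.
Qed.

Lemma cell_map_lipschitz u v : u <= v ->
  e * (v - u) <= cell_map v - cell_map u <= e^-1 * (v - u).
Proof.
move=> uv; rewrite /cell_map.
have Vuv : u / e <= v / e by rewrite ler_pM2r // invr_gt0.
have -> : e^-1 * (v - u) = v / e - u / e by ring.
have -> : v - u = e * (v / e - u / e).
  by rewrite -mulrBl mulrC divfK // gt_eqF.
set U := u / e in Vuv *; set V := v / e in Vuv *.
have [uE vE] : u = e * U /\ v = e * V by rewrite ![e * _]mulrC !divfK ?gt_eqF.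
have ee : e * e * (V - U) <= e * (V - U).
  by rewrite ler_wpM2r ?subr_ge0 // ger_pMr // ltW.
have : 0 <= (1 - e) * (Num.min V 1 - Num.min U 1) <= (1 - e) * (V - U).
  have eC : 0 <= 1 - e by rewrite subr_ge0 ltW.
  apply/andP; split; first by apply: mulr_ge0 => //; case: (leP V 1); case: (leP U 1); lra.
  by apply: ler_wpM2l => //; case: (leP V 1); case: (leP U 1); lra.
by rewrite {}uE {}vE => /andP[h1 h2]; apply/andP; split; lra.
Qed.

Definition periodic_map z : R :=
  (Num.floor z)%:~R + cell_map (z - (Num.floor z)%:~R).

Lemma floor_rem z : 0 <= z - (Num.floor z)%:~R <= 1.
Proof.
have /andP[h1 h2] := floor_itv z.
by rewrite subr_ge0 h1 lerBlDl ltW //= -[1]/(1%:~R) -intrD.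
Qed.

(** Cut [y, z] at integers: whole cells are mapped onto themselves, with mean slope 1 between [e]
    and 1/e, so crossing cells does not worsen the constants of [cell_map]. *)
Lemma periodic_map_lipschitz y z : y <= z ->
  e * (z - y) <= periodic_map z - periodic_map y <= e^-1 * (z - y).
Proof.
move=> yz; rewrite /periodic_map.
have := le_floor yz; rewrite le_eqVlt => /predU1P[fyz|].
  by have := cell_map_lipschitz (y - (Num.floor y)%:~R) (z - (Num.floor z)%:~R);
    rewrite fyz lerB // => /(_ isT); lra.
rewrite -lezD1 -(ler_int R) intrD.
have /andP[ry0 ry1] := floor_rem y; have /andP[rz0 rz1] := floor_rem z.
set k := (Num.floor y)%:~R in ry0 ry1 *; set l := (Num.floor z)%:~R in rz0 rz1 *.
have /andP := cell_map_lipschitz _ _ ry1; have /andP := cell_map_lipschitz _ _ rz0.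
rewrite cell_map0 cell_map1 => -[h1 h2] [h3 h4] kl.
have D0 : 0 <= l - k - 1 by lra.
have D1 : e * (l - k - 1) <= l - k - 1 by rewrite ler_piMl // ltW.
have D2 : l - k - 1 <= e^-1 * (l - k - 1).
  by rewrite -{1}[l - k - 1]mul1r ler_wpM2r // invf_ge1 // ltW.
by apply/andP; split; lra.
Qed.

Lemma periodic_map_near z : `|periodic_map z - z| <= 1.
Proof.
rewrite /periodic_map; have /andP[r0 r1] := floor_rem z.
have /andP[+ _] := cell_map_lipschitz _ _ r0.
have /andP[+ _] := cell_map_lipschitz _ _ r1.
rewrite cell_map0 cell_map1 => h1 h2.
have : 0 <= e * (1 - (z - (Num.floor z)%:~R)) by rewrite mulr_ge0 ?subr_ge0 // ltW.
have : 0 <= e * (z - (Num.floor z)%:~R) by rewrite mulr_ge0 // ltW.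
by rewrite ler_norml; lra.
Qed.

Lemma periodic_map_nat (j : nat) u : 0 <= u < 1 ->
  periodic_map (j%:R + u) = j%:R + cell_map u.
Proof.
move=> u01; rewrite /periodic_map.
have -> : Num.floor (j%:R + u) = j%:Z.
  apply: floor_def; rewrite -[X in _ <= _ < X%:~R]/(j%:Z + 1) intrD.
  by rewrite -pmulrn lerDl ltrD2l.
by rewrite -pmulrn addrAC subrr add0r.
Qed.

Definition expansion N y : R := periodic_map (N%:R * y) / N%:R.

(** Source and target are rescaled by the same factor, so the constants do not depend on [N],
    whereas the distance to the identity is at most 1/N. *)
Lemma expansion_lipschitz N y z : (0 < N)%N -> y <= z ->
  e * (z - y) <= expansion N z - expansion N y <= e^-1 * (z - y).
Proof.
move=> N0 yz; have q0 : 0 < N%:R :> R by rewrite ltr0n.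
have := periodic_map_lipschitz (N%:R * y) (N%:R * z).
rewrite ler_pM2l // => /(_ yz); rewrite /expansion -mulrBl -mulrBr.
by rewrite ler_pdivlMr // ler_pdivrMr // ![_ * (N%:R * _)]mulrCA ![N%:R * _]mulrC.
Qed.

Lemma expansion_near N y : (0 < N)%N -> `|expansion N y - y| <= N%:R^-1.
Proof.
move=> N0; have q0 : 0 < N%:R :> R by rewrite ltr0n.
have -> : expansion N y - y = (periodic_map (N%:R * y) - N%:R * y) / N%:R.
  by rewrite mulrBl [X in _ = _ - X]mulrC mulKf ?gt_eqF.
rewrite normrM normfV normr_nat ler_pdivrMr // mulVf ?gt_eqF //.
exact: periodic_map_near.
Qed.

Lemma expansion_cell N (j : nat) u : (0 < N)%N -> 0 <= u < 1 ->
  expansion N ((j%:R + u) / N%:R) = (j%:R + cell_map u) / N%:R.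
Proof.
move=> N0 u01; have q0 : N%:R != 0 :> R by rewrite pnatr_eq0 -lt0n.
by rewrite /expansion [N%:R * _]mulrC divfK // periodic_map_nat.
Qed.

Lemma expansion_node N (j : nat) : (0 < N)%N -> expansion N (j%:R / N%:R) = j%:R / N%:R.
Proof.
move=> N0; have := expansion_cell N j 0 N0.
by rewrite lexx ltr01 cell_map0 !addr0; apply.
Qed.

Lemma expansion_itv N y : (0 < N)%N -> 0 <= y <= 1 -> 0 <= expansion N y <= 1.
Proof.
move=> N0 /andP[y0 y1].
have := expansion_node N 0 N0; have := expansion_node N N N0.
rewrite mul0r divff ?pnatr_eq0 -?lt0n // => T1 T0.
have /andP[+ _] := expansion_lipschitz _ _ _ N0 y0; rewrite T0.
have /andP[+ _] := expansion_lipschitz _ _ _ N0 y1; rewrite T1.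
have : 0 <= e * (y - 0) by rewrite mulr_ge0 ?subr_ge0 // ltW.
have : 0 <= e * (1 - y) by rewrite mulr_ge0 ?subr_ge0 // ltW.
by lra.
Qed.

Lemma expansion_continuous N : (0 < N)%N -> continuous (expansion N).
Proof.
move=> N0 y; apply/cvgrPdist_le => d d0; apply/nbhs_ballP.
exists (e * d); first by rewrite /= mulr_gt0.
move=> z /= /ltW; rewrite /ball /=.
wlog yz : y z / y <= z => [H|].
  have [yz|/ltW zy] := leP y z; first exact: H.
  by rewrite distrC [X in _ -> X <= _]distrC; exact: H.
have /andP[h1 h2] := expansion_lipschitz _ _ _ N0 yz.
have h0 : 0 <= expansion N z - expansion N y.
  by apply: le_trans h1; rewrite mulr_ge0 ?subr_ge0 // ltW.
rewrite distrC ger0_norm ?subr_ge0 // => zyd.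
rewrite distrC ger0_norm // (le_trans h2) // mulrC ler_pdivrMr // mulrC.
by [].
Qed.

End periodic_expansion.

(** * Continuously differentiable step functions *)

Section C1_step.
Context {R : realType}.
Implicit Types x h : R.

(** After division by [h] the remainder is at most K |h|. This criterion is additive and treats the
    knots of a piecewise quadratic function like all other points. *)
Lemma is_derive_quadratic (F dF : R -> R) K :
  (forall x h, `|F (x + h) - F x - dF x * h| <= K * h ^+ 2) ->
  forall x : R, is_derive x 1 F (dF x).
Proof.
move=> FK x.
have K0 : 0 <= K by have := FK x 1; rewrite expr1n !mulr1; apply: le_trans; exact: normr_ge0.
have H : (h^-1 *: (F (h *: 1 + x) - F x)) @[h --> 0^'] --> dF x.
  apply/cvgrPdist_le => e e0.
  have Ke : 0 < e / (K + 1) by rewrite divr_gt0 // ltr_wpDl.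
  exists (e / (K + 1)) => //= h /=; rewrite sub0r normrN => /ltW he h0.
  rewrite [h *: 1]mulr1 distrC [h + x]addrC.
  have -> : h^-1 *: (F (x + h) - F x) - dF x = h^-1 * (F (x + h) - F x - dF x * h).
    by rewrite [h^-1 *: _]/(h^-1 * _) mulrBr [dF x * h]mulrC mulKf.
  rewrite normrM normfV mulrC ler_pdivrMr ?normr_gt0 // (le_trans (FK x h)) //.
  rewrite -real_normK ?num_real // expr2 mulrA ler_wpM2r //.
  move: he; rewrite ler_pdivlMr ?ltr_wpDl // => he.
  by rewrite (le_trans _ he) // mulrDr mulr1 mulrC lerDl.
apply: DeriveDef; last exact: cvg_lim H.
by apply/cvg_ex; exists (dF x).
Qed.

(** The square of the positive part of [x]; its derivative is x + |x|. *)
Definition pos_sq x : R := (x + `|x|) * x / 2.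

Lemma pos_sq_le0 x : x <= 0 -> pos_sq x = 0.
Proof. by move=> x0; rewrite /pos_sq ler0_norm // subrr !mul0r. Qed.

Lemma pos_sq_ge0 x : 0 <= x -> pos_sq x = x ^+ 2.
Proof. by move=> x0; rewrite /pos_sq ger0_norm //; field. Qed.

Lemma pos_sq_quadratic x h :
  `|pos_sq (x + h) - pos_sq x - (x + `|x|) * h| <= h ^+ 2.
Proof.
rewrite ler_norml; have [x0|x0] := leP 0 x; have [xh|xh] := leP 0 (x + h).
- by rewrite !pos_sq_ge0 // ger0_norm //; nra.
- by rewrite (pos_sq_le0 _ (ltW xh)) pos_sq_ge0 // ger0_norm //; nra.
- by rewrite (pos_sq_ge0 _ xh) (pos_sq_le0 _ (ltW x0)) [`|x|]ler0_norm ?(ltW x0) //; nra.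
- by rewrite !pos_sq_le0 ?(ltW x0) ?(ltW xh) // [`|x|]ler0_norm ?(ltW x0) //; nra.
Qed.

(* The integral of a tent function, that is, a quadratic B-spline step. *)
Lemma C1_step_exists (a b : R) : a < b -> exists w dw : R -> R,
  [/\ forall x : R, is_derive x 1 w (dw x), continuous dw,
      forall x, 0 <= w x <= 1,
      forall x, x <= a -> w x = 0 & forall x, b <= x -> w x = 1].
Proof.
move=> ab; have ba : 0 < b - a by rewrite subr_gt0.
pose t x := (x - a) / (b - a).
pose d x := x + `|x|.
(* This is 2 t^2 on [0, 1/2] and 1 - 2 (1 - t)^2 on [1/2, 1]. *)
pose w x := 2 * (pos_sq (t x) - 2 * pos_sq (t x - 1 / 2) + pos_sq (t x - 1)).
pose dw x := 2 / (b - a) * (d (t x) - 2 * d (t x - 1 / 2) + d (t x - 1)).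
have w0 x : t x <= 0 -> w x = 0.
  by move=> tx; rewrite /w !pos_sq_le0 //; lra.
have w1 x : 1 <= t x -> w x = 1.
  by move=> tx; rewrite /w !pos_sq_ge0 //; try lra; field.
exists w, dw; split.
(* 8 = 2 (1 + 2 + 1) adds up the absolute values of the coefficients of [w], each term having
   remainder constant 1. *)
- apply: (is_derive_quadratic _ _ (8 / (b - a) ^+ 2)) => x h.
  have tE : t (x + h) = t x + h / (b - a) by rewrite /t; ring.
  set k := h / (b - a) in tE.
  have -> : dw x * h = 2 * (d (t x) - 2 * d (t x - 1 / 2) + d (t x - 1)) * k.
    by rewrite /dw /k; ring.
  have -> : 8 / (b - a) ^+ 2 * h ^+ 2 = 8 * k ^+ 2.
    by rewrite /k; field; rewrite gt_eqF.
  rewrite /w tE.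
  have := pos_sq_quadratic (t x) k; have := pos_sq_quadratic (t x - 1 / 2) k.
  have := pos_sq_quadratic (t x - 1) k; rewrite -/(d _) -/(d _) -/(d _).
  rewrite ![t x - _ + k]addrAC !ler_norml.
  by move=> /andP[? ?] /andP[? ?] /andP[? ?]; apply/andP; split; lra.
- have cd c : continuous (fun x => d (t x - c)).
    have ct : continuous (fun x => t x - c).
      by move=> x; apply: cvgB; [apply: cvgM; [apply: cvgB|]|];
        try exact: cvg_cst; exact: cvg_id.
    by move=> x; apply: cvgD; [exact: ct|apply: cvg_norm; exact: ct].
  move=> x; apply: cvgM; first exact: cvg_cst.
  apply: cvgD; last exact: cd.
  apply: cvgB; last by apply: cvgM; [exact: cvg_cst|exact: cd].
  by have := cd 0 x; rewrite /continuous_at; under eq_cvg do rewrite subr0; rewrite subr0.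
- move=> x; have [t0|t0] := leP (t x) 0; first by rewrite w0 // lexx ler01.
  have [t1|t1] := leP 1 (t x); first by rewrite w1 // lexx ler01.
  rewrite /w (pos_sq_ge0 _ (ltW t0)) (pos_sq_le0 _ (_ : t x - 1 <= 0)); last by lra.
  have [t2|t2] := leP (t x) (1 / 2).
    rewrite (pos_sq_le0 _ (_ : t x - 1 / 2 <= 0)); last by lra.
    by apply/andP; split; nra.
  rewrite (pos_sq_ge0 _ (_ : 0 <= t x - 1 / 2)); last by lra.
  by apply/andP; split; nra.
- by move=> x xa; apply: w0; rewrite /t pmulr_lle0 ?invr_gt0 // subr_le0.
- by move=> x bx; apply: w1; rewrite /t ler_pdivlMr // mul1r lerD2r.
Qed.

End C1_step.

(** * Regularization *)

Section interp_more.
Context {R : realType}.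
Implicit Types (F DF : R * R -> R) (a : nat -> R).

Lemma C1x_sum n (F DF : nat -> R * R -> R) :
  (forall j, (j < n)%N -> C1x (F j) (DF j)) ->
  C1x (fun p => \sum_(j < n) F j p) (fun p => \sum_(j < n) DF j p).
Proof.
elim: n => [|n IH] H.
  rewrite (_ : (fun p => \sum_(j < 0) F j p) = fun=> 0); last first.
    by apply/funext => p; rewrite big_ord0.
  rewrite (_ : (fun p => \sum_(j < 0) DF j p) = fun=> 0); first exact: C1x_cst.
  by apply/funext => p; rewrite big_ord0.
rewrite (_ : (fun p => \sum_(j < n.+1) F j p) = fun p => \sum_(j < n) F j p + F n p).
  rewrite (_ : (fun p => \sum_(j < n.+1) DF j p) =
              fun p => \sum_(j < n) DF j p + DF n p).
    by apply: C1xD; [apply: IH => j jn; apply: H; exact: ltnW|exact: H].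
  by apply/funext => p; rewrite big_ord_recr.
by apply/funext => p; rewrite big_ord_recr.
Qed.

Lemma node_itv (N j : nat) : (j < N.+1)%N -> (0 < N)%N -> 0 <= (j%:R / N%:R : R) <= 1.
Proof.
move=> jN N0; rewrite divr_ge0 //= ler_pdivrMr ?ltr0n // mul1r ler_nat.
by rewrite -ltnS.
Qed.

Lemma C1x_interp F DF N : (0 < N)%N -> C1x F DF ->
  C1x (fun p => interp N (fun j => F (p.1, j%:R / N%:R)) p.2)
      (fun p => interp N (fun j => DF (p.1, j%:R / N%:R)) p.2).
Proof.
move=> N0 FDF.
apply: (C1x_sum N.+1 (fun j p => F (p.1, j%:R / N%:R) * hat N j p.2)
  (fun j p => DF (p.1, j%:R / N%:R) * hat N j p.2)) => j jN.
rewrite (_ : (fun p => DF (p.1, j%:R / N%:R) * hat N j p.2) = fun p =>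
  DF (p.1, j%:R / N%:R) * hat N j p.2 + F (p.1, j%:R / N%:R) * 0); last first.
  by apply/funext => p; rewrite mulr0 addr0.
apply: (C1xM _ (fun p => DF (p.1, j%:R / N%:R)) _ (fun=> 0)).
  apply: (C1x_comp_y F DF (fun=> j%:R / N%:R)) => //.
    by apply: continuous_subspaceT => ?; exact: cst_continuous.
  by move=> _ _; exact: node_itv.
by apply: C1x_y; apply: continuous_subspaceT; exact: hat_continuous.
Qed.

Lemma interp_id N (y : R) : (0 < N)%N -> 0 <= y <= 1 ->
  interp N (fun j => j%:R / N%:R) y = y.
Proof.
move=> N0 y01; have [i [u [iN u01 ->]]] := unit_itv_cell N y N0 y01.
by rewrite interp_cell // -natr1; ring.
Qed.

Lemma interp_left N a : (0 < N)%N -> interp N a 0 = a 0%N.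
Proof.
move=> N0; have := interp_cell N 0 a 0 N0.
by rewrite lexx ler01 addr0 mul0r subr0 mul1r mul0r addr0 => /(_ isT).
Qed.

Lemma interp_right N a : (0 < N)%N -> interp N a 1 = a N.
Proof.
move=> N0; have := interp_cell N N.-1 a 1; rewrite prednK // leqnn lexx ler01.
rewrite natr1 prednK // divff ?pnatr_eq0 -?lt0n // subrr mul0r add0r mul1r.
by apply.
Qed.

Lemma interp_opp N a y : interp N (fun j => - a j) y = - interp N a y.
Proof. by rewrite /interp -sumrN; apply: eq_bigr => j _; rewrite mulNr. Qed.

(** The interpolated value is a convex combination of the values at two nodes within 1/N of [y]. *)
Lemma interp_near N a y c d : (0 < N)%N -> 0 <= y <= 1 ->
  (forall j, (j < N.+1)%N -> `|j%:R / N%:R - y| <= N%:R^-1 -> `|a j - c| <= d) ->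
  `|interp N a y - c| <= d.
Proof.
move=> N0 y01 ad; have [i [u [iN /[dup] u01 /andP[u0 u1] yE]]] := unit_itv_cell N y N0 y01.
have q0 : 0 < N%:R :> R by rewrite ltr0n.
have qV : 0 < N%:R^-1 :> R by rewrite invr_gt0.
rewrite {1}yE interp_cell //.
have -> : (1 - u) * a i + u * a i.+1 - c = (1 - u) * (a i - c) + u * (a i.+1 - c).
  by ring.
have uC : 0 <= 1 - u by rewrite subr_ge0.
rewrite (le_trans (ler_normD _ _)) // !normrM (ger0_norm u0) (ger0_norm uC).
have h1 : `|a i - c| <= d.
  apply: ad; first exact: ltnW.
  rewrite yE -mulrBl opprD addNKr normrM normrN normfV normr_nat ger0_norm //.
  by rewrite ler_piMl // ltW.
have h2 : `|a i.+1 - c| <= d.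
  apply: ad => //; rewrite yE -natr1 -mulrBl.
  have -> : i%:R + 1 - (i%:R + u) = 1 - u by ring.
  rewrite normrM normfV normr_nat ger0_norm //.
  by rewrite ler_piMl ?(ltW qV) // gerBl.
have -> : d = (1 - u) * d + u * d by ring.
by apply: lerD; apply: ler_wpM2l.
Qed.

End interp_more.

(** Having [lo] and [hi] in place of C^-1 and C allows a strict margin C^-1 < lo, hi < C to be
    stated; [l] and [L] add bi-Lipschitz bounds. *)
Record regular_chart {R : realType} (beta lo hi l L : R) (F DF : R * R -> R) : Prop :=
  RegularChart {
    regular_C1x : C1x F DF ;
    regular_left : forall y : R, 0 <= y <= 1 -> F (0, y) = y ;
    regular_bot : forall x : R, 0 <= x <= 1 -> F (x, 0) = 0 ;
    regular_top : forall x : R, 0 <= x <= 1 -> F (x, 1) = 1 ;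
    regular_holder : forall x y1 y2, 0 <= x <= 1 -> 0 <= y1 -> y1 < y2 -> y2 <= 1 ->
      lo * (y2 - y1) `^ beta^-1 <= F (x, y2) - F (x, y1) <= hi * (y2 - y1) `^ beta ;
    regular_lipschitz : forall x y1 y2, 0 <= x <= 1 -> 0 <= y1 -> y1 <= y2 -> y2 <= 1 ->
      l * (y2 - y1) <= F (x, y2) - F (x, y1) <= L * (y2 - y1) }.

Section regularization.
Context {R : realType} {C beta alpha : R}.
Hypotheses (C1 : 1 < C) (b0 : 0 < beta) (b1 : beta < 1).
Implicit Type f : bihol_space C beta alpha.

Let C0 : 0 < C. Proof. exact: lt_trans ltr01 C1. Qed.
Let bV : 1 <= beta^-1. Proof. by rewrite invf_ge1 // ltW. Qed.

(** The moduli C t^beta and - C^-1 t^(1/beta) are concave, so [interp_modulus] carries both Hoelder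
    bounds over without loss. *)
Lemma regular_interp f N : (0 < N)%N ->
  regular_chart beta C^-1 C 0 (C * N%:R)
    (fun p => interp N (fun j => f (p.1, j%:R / N%:R)) p.2)
    (fun p => interp N (fun j => partial_x f (p.1, j%:R / N%:R)) p.2).
Proof.
move=> N0; have q0 : 0 < N%:R :> R by rewrite ltr0n.
have nodes x i j : 0 <= x <= 1 -> (i < j)%N -> (j <= N)%N ->
    C^-1 * ((j%:R - i%:R) / N%:R) `^ beta^-1 <=
    f (x, j%:R / N%:R) - f (x, i%:R / N%:R) <=
    C * ((j%:R - i%:R) / N%:R) `^ beta.
  move=> x01 ij jN; rewrite mulrBl; apply: bihol_incr => //.
  - by rewrite ltr_pM2r ?invr_gt0 // ltr_nat.
  - by rewrite ler_pdivrMr // mul1r ler_nat.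
have H x y1 y2 : 0 <= x <= 1 -> 0 <= y1 -> y1 < y2 -> y2 <= 1 ->
    C^-1 * (y2 - y1) `^ beta^-1 <=
    interp N (fun j => f (x, j%:R / N%:R)) y2 - interp N (fun j => f (x, j%:R / N%:R)) y1
    <= C * (y2 - y1) `^ beta.
  move=> x01 y10 y12 y21; apply/andP; split; last first.
    apply: (interp_modulus _ _ (fun t => C * t `^ beta)) => //.
    - move=> s t k s0 t0 k01; rewrite ![_ * (C * _)]mulrCA -mulrDr ler_pM2l //.
      by apply: powR_concave => //; rewrite b0 ltW.
    - by rewrite powR0 ?mulr0 // gt_eqF.
    - by move=> i j ij jN; have /andP[] := nodes x i j x01 ij jN.
  (* The lower bound is an upper bound for the negated interpolation. *)
  rewrite -lerN2 opprB addrC -interp_opp -[X in _ + X]opprK -interp_opp.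
  apply: (interp_modulus _ _ (fun t => - (C^-1 * t `^ beta^-1))) => //.
  - move=> s t k s0 t0 k01; rewrite !mulrN -opprD lerN2.
    rewrite ![_ * (C^-1 * _)]mulrCA -mulrDr ler_pM2l ?invr_gt0 //.
    exact: powR_convex.
  - by rewrite powR0 ?mulr0 ?oppr0 // gt_eqF // invr_gt0.
  - move=> i j ij jN; have /andP[+ _] := nodes x i j x01 ij jN.
    by rewrite -opprD lerN2.
split=> //.
- exact: C1x_interp N0 (bihol_C1x C1 b0 f).
- move=> y y01; rewrite /= -[RHS](interp_id N _ N0 y01) /interp.
  by apply: eq_bigr => j _; rewrite bihol_left // in_itv /= node_itv.
- by move=> x x01 /=; rewrite interp_left // mul0r bihol_bot.
- move=> x x01 /=; rewrite interp_right // divff ?bihol_top //.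
  by rewrite gt_eqF.
- move=> x y1 y2 x01 y10; rewrite le_eqVlt => /predU1P[->|y12] y21 /=.
    by rewrite !subrr !mulr0 lexx.
  apply/andP; split.
    rewrite mul0r; have /andP[+ _] := H x y1 y2 x01 y10 y12 y21.
    by apply: le_trans; rewrite mulr_ge0 ?powR_ge0 // invr_ge0 ltW.
  (* The distance t of distinct nodes satisfies 1/N <= t <= 1, hence t^beta <= 1 <= N t. *)
  apply: (interp_modulus _ _ (fun t => C * N%:R * t)) => //.
  - by move=> s t k _ _ _; rewrite le_eqVlt; apply/orP; left; apply/eqP; ring.
  - by rewrite mulr0.
  - move=> i j ij jN; have /andP[_] := nodes x i j x01 ij jN.
    move/le_trans; apply; rewrite -mulrA ler_pM2l // [leRHS]mulrC divfK ?gt_eqF //.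
    have ji : 1 <= j%:R - i%:R :> R.
      by rewrite lerBrDl natr1 ler_nat.
    have one : 1 `^ beta = 1 by rewrite powR1.
    apply: le_trans ji; rewrite -[leRHS]one; apply: ge0_ler_powR.
    + exact: ltW.
    + by rewrite nnegrE divr_ge0 // subr_ge0 ler_nat ltnW.
    + by rewrite nnegrE.
    + rewrite ler_pdivrMr // mul1r lerBlDr -natrD ler_nat.
      by rewrite (leq_trans jN) // leq_addr.
Qed.

(** On lengths t <= 1 the identity satisfies both Hoelder bounds with constant 1, as t^(1/beta) <= t
    <= t^beta; it also contributes the positive lower slope [s]. *)
Lemma regular_mix (s L : R) (F DF : R * R -> R) : 0 < s < 1 ->
  regular_chart beta C^-1 C 0 L F DF ->
  regular_chart beta ((1 - s) * C^-1 + s) ((1 - s) * C + s) s ((1 - s) * L + s)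
    (fun p => (1 - s) * F p + s * p.2) (fun p => (1 - s) * DF p).
Proof.
move=> /andP[s0 s1] [FDF Fl Fb Ft FH FL].
have sC : 0 < 1 - s by rewrite subr_gt0.
have cid : {within `[0, 1], continuous (fun y : R => y)}.
  by apply: continuous_subspaceT => ?; exact: cvg_id.
split.
- have := C1xD _ _ _ _ (C1xM _ _ _ _ (C1x_cst (1 - s)) FDF)
    (C1xM _ _ _ _ (C1x_cst s) (C1x_y (fun y => y) cid)).
  congr C1x; apply/funext => p; ring.
- by move=> y y01; rewrite Fl //=; ring.
- by move=> x x01; rewrite Fb //=; ring.
- by move=> x x01; rewrite Ft //=; ring.
- move=> x y1 y2 x01 y10 y12 y21 /=.
  have d01 : 0 < y2 - y1 <= 1 by rewrite subr_gt0 y12 /=; lra.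
  have h1 : (y2 - y1) `^ beta^-1 <= y2 - y1 by exact: ge1r_powR.
  have h2 : y2 - y1 <= (y2 - y1) `^ beta.
    by rewrite -[leLHS]powRr1 ?(ltW (proj1 (andP d01))) // ger_powR // ltW.
  have /andP[h3 h4] := FH x y1 y2 x01 y10 y12 y21.
  have -> : (1 - s) * F (x, y2) + s * y2 - ((1 - s) * F (x, y1) + s * y1) =
    (1 - s) * (F (x, y2) - F (x, y1)) + s * (y2 - y1) by ring.
  rewrite ![(_ + s) * _]mulrDl -[_ * C^-1 * _]mulrA -[_ * C * _]mulrA.
  by apply/andP; split; apply: lerD; rewrite ler_pM2l.
- move=> x y1 y2 x01 y10 y12 y21 /=.
  have /andP[h3 h4] := FL x y1 y2 x01 y10 y12 y21.
  have -> : (1 - s) * F (x, y2) + s * y2 - ((1 - s) * F (x, y1) + s * y1) =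
    (1 - s) * (F (x, y2) - F (x, y1)) + s * (y2 - y1) by ring.
  rewrite [(_ + s) * _]mulrDl -[_ * L * _]mulrA lerD2r ler_pM2l // h4 andbT lerDr mulr_ge0 ?(ltW sC) //.
  by rewrite mul0r in h3.
Qed.

Lemma bihol_regularization f (e : R) : 0 < e -> exists lo hi l L F DF,
  [/\ [/\ C^-1 < lo, hi < C, 0 < l & 0 < L], regular_chart beta lo hi l L F DF,
      forall p, unit_square p -> `|F p - f p| <= e &
      forall p, unit_square p -> `|DF p - partial_x f p| <= e].
Proof.
move=> e0; have e2 : 0 < e / 2 by rewrite divr_gt0.
have [cf cDf _] := bihol_C1x C1 b0 f.
have [d1 d10 d1P] := unit_square_unif_continuous _ cf _ e2.
have [d2 d20 d2P] := unit_square_unif_continuous _ cDf _ e2.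
have d0 : 0 < Num.min d1 d2 by rewrite lt_min d10.
have [N N0 Nd] : exists2 N, (0 < N)%N & N%:R^-1 < Num.min d1 d2.
  exists (Num.truncn (Num.min d1 d2)^-1).+1 => //.
  by rewrite invf_plt ?posrE // truncnS_gt.
have rF := regular_interp f N N0; have [[cF cDF _] _ _ _ _ _] := rF.
set F := fun p => _ in rF cF; set DF := fun p => _ in rF cDF.
have near (G : R * R -> R) d p : Num.min d1 d2 <= d ->
    (forall x x' y y', unit_square (x, y) -> unit_square (x', y') ->
      `|x - x'| < d -> `|y - y'| < d -> `|G (x, y) - G (x', y')| < e / 2) ->
    unit_square p -> `|interp N (fun j => G (p.1, j%:R / N%:R)) p.2 - G p| <= e / 2.
  case: p => x y dd GP /unit_squareP[x01 y01]; apply: interp_near => // j jN jy.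
  apply/ltW/GP; rewrite ?subrr ?normr0; try apply/unit_squareP => //.
  - by split => //; exact: node_itv.
  - exact: lt_le_trans dd.
  - exact: le_lt_trans jy (lt_le_trans Nd dd).
have Ff p : unit_square p -> `|F p - f p| <= e / 2.
  by apply: near d1P; rewrite ge_min lexx.
have DFf p : unit_square p -> `|DF p - partial_x f p| <= e / 2.
  by apply: near d2P; rewrite ge_min lexx orbT.
have [M M0 MP] := unit_square_bounded _ cF.
have [M' M'0 M'P] := unit_square_bounded _ cDF.
(* [1 + M] bounds |y - F| and [M'] bounds |DF|, so averaging moves the function and its derivative
   by at most s (1 + M + M') <= e / 2. *)
pose s := Num.min (1 / 2) (e / 2 / (1 + M + M')).
have K0 : 0 < 1 + M + M' by rewrite !addr_gt0.
have s0 : 0 < s by rewrite lt_min !divr_gt0.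
have s1 : s < 1 by rewrite gt_min ltr_pdivrMr // mul1r ltr1n.
have sK : s * (1 + M + M') <= e / 2.
  by rewrite -ler_pdivlMr // /s ge_min lexx orbT.
have CV : C^-1 < 1 by rewrite invf_lt1.
have s01 : 0 < s < 1 by rewrite s0.
exists ((1 - s) * C^-1 + s), ((1 - s) * C + s), s, ((1 - s) * (C * N%:R) + s).
exists (fun p => (1 - s) * F p + s * p.2), (fun p => (1 - s) * DF p); split.
(* These are the margins C - hi = s (C - 1) and lo - C^-1 = s (1 - C^-1). *)
- have sC : 0 < s * (C - 1) by rewrite mulr_gt0 // subr_gt0.
  have sV : 0 < s * (1 - C^-1) by rewrite mulr_gt0 // subr_gt0.
  split=> //; [by lra|by lra|].
  by rewrite addr_gt0 // !mulr_gt0 ?subr_gt0 // ltr0n.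
- exact: regular_mix.
- move=> p Mp; have -> : (1 - s) * F p + s * p.2 - f p = (F p - f p) + s * (p.2 - F p).
    by ring.
  rewrite [e]splitr (le_trans (ler_normD _ _)) // lerD ?Ff // normrM gtr0_norm //.
  apply: le_trans sK; rewrite ler_pM2l // (le_trans (ler_normB _ _)) //.
  have p2 : `|p.2| <= 1.
    by case: p Mp => x y /unit_squareP[_ /andP[y0 y1]]; rewrite ger0_norm.
  by have := MP p Mp; lra.
- move=> p Mp; have -> : (1 - s) * DF p - partial_x f p =
    (DF p - partial_x f p) - s * DF p by ring.
  rewrite [e]splitr (le_trans (ler_normB _ _)) // lerD ?DFf // normrM gtr0_norm //.
  apply: le_trans sK; rewrite ler_pM2l //.
  by have := M'P p Mp; lra.
Qed.

End regularization.

(** * Open dense conditions *)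

Section splitting.
Context {R : realType}.
Implicit Types (f F : R * R -> R) (a b eta e x : R) (N : nat).

(** For f (x, .) increasing, this is the length cut out on the vertical at [x] by the leaves that
    start in the intervals [j/N, (j+e)/N[; [high_mass] is the length of the rest. As finite sums of
    values of [f], both are stable under uniform perturbation. *)
Definition low_mass f N e x : R :=
  \sum_(j < N) (f (x, (j%:R + e) / N%:R) - f (x, j%:R / N%:R)).

Definition high_mass f N e x : R :=
  \sum_(j < N) (f (x, j.+1%:R / N%:R) - f (x, (j%:R + e) / N%:R)).

(* The leaves starting in the union of the intervals [j/N, (j+e)/N[ fill little of
   the verticals over [0, a] and almost all of the verticals over [b, 1]; asking
   for a uniform margin makes this an open condition. *)
Definition splitting a b eta f := exists N e eta',
  [/\ (0 < N)%N, 0 < e < 1, eta' < eta,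
      forall x, 0 <= x <= 1 -> x <= a -> low_mass f N e x <= eta' &
      forall x, 0 <= x <= 1 -> b <= x -> high_mass f N e x <= eta'].

Lemma sum_le_const N (s : 'I_N -> R) c : (0 < N)%N ->
  (forall j, s j <= c / N%:R) -> \sum_(j < N) s j <= c.
Proof.
move=> N0 sc; apply: (@le_trans _ _ (\sum_(j < N) c / N%:R)).
  by apply: ler_sum => j _.
by rewrite sumr_const card_ord -[leLHS]mulr_natr divfK // pnatr_eq0 -lt0n.
Qed.

Lemma inner_node_itv N (j : nat) e : (j < N)%N -> 0 < e < 1 ->
  0 <= (j%:R + e) / N%:R <= 1.
Proof.
move=> jN /andP[e0 e1]; have q0 : 0 < N%:R :> R by rewrite ltr0n (leq_ltn_trans _ jN).
rewrite divr_ge0 ?addr_ge0 ?(ltW e0) //= ler_pdivrMr // mul1r.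
have : j.+1%:R <= N%:R :> R by rewrite ler_nat.
by rewrite -natr1; lra.
Qed.

Lemma mass_perturb f g N e r x : (0 < N)%N -> 0 < e < 1 -> 0 <= x <= 1 ->
  (forall p, unit_square p -> `|f p - g p| <= r) ->
  low_mass g N e x <= low_mass f N e x + 2 * r * N%:R /\
  high_mass g N e x <= high_mass f N e x + 2 * r * N%:R.
Proof.
move=> N0 e01 x01 fg; have q0 : N%:R != 0 :> R by rewrite pnatr_eq0 -lt0n.
have H y : 0 <= y <= 1 -> - r <= f (x, y) - g (x, y) <= r.
  by move=> y01; rewrite -ler_norml; apply: fg; apply/unit_squareP.
split; rewrite -lerBlDl -sumrB;
  apply: sum_le_const => // -[j jN] /=; rewrite mulfK //.
- have /andP[? ?] := H _ (node_itv N j (leqW jN) N0).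
  by have /andP[? ?] := H _ (inner_node_itv N j e jN e01); lra.
- have /andP[? ?] := H _ (node_itv N j.+1 jN N0).
  by have /andP[? ?] := H _ (inner_node_itv N j e jN e01); lra.
Qed.

End splitting.

(** * Openness and density of the splitting conditions *)

Section splitting_open_dense.
Context {R : realType} {C beta alpha : R}.
Hypotheses (C1 : 1 < C) (a0 : 0 <= alpha) (ab : alpha < beta) (b1 : beta < 1).
Notation T := (bihol_space C beta alpha).
Implicit Types f g : T.

Let C0 : 0 < C. Proof. exact: lt_trans ltr01 C1. Qed.
Let b0 : 0 < beta. Proof. exact: le_lt_trans ab. Qed.

Lemma dist_alpha_C0 f g (r : R) : (dist_alpha alpha f g < r%:E)%E ->
  forall p, unit_square p -> `|f p - g p| <= r.
Proof.
move=> fgr p Mp; rewrite -lee_fin; apply: le_trans (ltW fgr).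
apply: (@le_trans _ _ (C0_norm (f \- g))).
  by apply: ereal_sup_ubound; exists p.
rewrite /dist_alpha -addeA leeDl // adde_ge0 ?C0_norm_ge0 //.
exact: holonomy_dist_ge0.
Qed.

Lemma open_splitting (a b eta : R) : open [set f : T | splitting a b eta f].
Proof.
rewrite openE => f [N [e [eta' [N0 e01 etaE lowf highf]]]].
have q0 : 0 < N%:R :> R by rewrite ltr0n.
(* Each of the [N] terms changes by at most 2 r, so the masses change by at most half of the
   margin. *)
pose r := (eta - eta') / (4 * N%:R).
have r0 : 0 < r by rewrite divr_gt0 ?subr_gt0 // mulr_gt0.
have rE : 2 * r * N%:R = (eta - eta') / 2.
  by rewrite /r; field; rewrite gt_eqF.
apply/nbhs_ballP; exists r => // g fg; exists N, e, (eta' + 2 * r * N%:R).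
have {}fg := dist_alpha_C0 _ _ _ fg.
split=> //; first by rewrite rE; lra.
- move=> x x01 xa; have [h _] := mass_perturb _ _ _ _ _ _ N0 e01 x01 fg.
  by apply: le_trans h _; rewrite lerD2r lowf.
- move=> x x01 xa; have [_ h] := mass_perturb _ _ _ _ _ _ N0 e01 x01 fg.
  by apply: le_trans h _; rewrite lerD2r highf.
Qed.

(** The order of choices matters: [e] depends on [L] and [eta], the scale [d] on the resulting
    slopes l e and L / e, the tolerance [k] on [d], and [N] comes last. This is not circular,
    because those slopes do not depend on [N]. *)
Lemma splitting_perturbation (a b eta eps : R) lo hi l L (F DF : R * R -> R) :
  0 <= a -> a < b -> 0 < eta -> 0 < eps ->
  C^-1 < lo -> hi < C -> 0 < l -> 0 < L ->
  regular_chart beta lo hi l L F DF ->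
  exists g : T, [/\ splitting a b eta g,
    forall p, unit_square p -> `|g p - F p| <= eps &
    forall p, unit_square p -> `|partial_x g p - DF p| <= eps].
Proof.
move=> a0' a_b eta0 eps0 loC hiC l0 L0 [FDF Fl Fb Ft FH FL].
have [w [dw [wdw cdw w01 wa wb]]] := C1_step_exists a b a_b.
have [cF cDF _] := FDF.
have [W W0 WP] : exists2 W, 0 < W & forall x, 0 <= x <= 1 -> `|dw x| <= W.
  have [_ cw _] := C1x_x w dw wdw cdw.
  have [W W0 WP] := unit_square_bounded _ cw; exists W => // x x01.
  by apply: (WP (x, 0)); apply/unit_squareP; rewrite lexx ler01.
pose e := Num.min (1 / 2) (eta / (2 * L)).
have e0 : 0 < e by rewrite lt_min !divr_gt0 // mulr_gt0.
have e1 : e < 1 by rewrite gt_min ltr_pdivrMr // mul1r ltr1n.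
have e01 : 0 < e < 1 by rewrite e0.
have Le : L * e < eta.
  apply: (@le_lt_trans _ _ (L * (eta / (2 * L)))).
    by rewrite ler_pM2l // ge_min lexx orbT.
  have -> : L * (eta / (2 * L)) = eta / 2 by field; rewrite gt_eqF.
  by lra.
have le0 : 0 < l * e by rewrite mulr_gt0.
have LeV : 0 < L / e by rewrite divr_gt0.
have bC : 0 < 1 - beta by rewrite subr_gt0.
have bVC : 0 < beta^-1 - 1 by rewrite subr_gt0 invf_gt1.
(* For lengths t up to [d1] and [d2], (L / e) t <= C t^beta and C^-1 t^(1/beta) <= l e t: the
   Lipschitz bounds imply the Hoelder bounds. *)
have [d1 d10 d1P] := powR_small _ _ _ LeV bC C0.
have CV0 : 0 < C^-1 by rewrite invr_gt0.
have [d2 d20 d2P] := powR_small _ _ _ CV0 bVC le0.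
pose d := Num.min d1 d2.
have d0 : 0 < d by rewrite lt_min d10.
(* For lengths above [d], an error [k] at each end costs 2 k, which the margins of [hi] and [lo]
   absorb. The other two terms keep the function within [eps] and the contribution of [dw] to the
   derivative within eps / 2. *)
pose k := Num.min (Num.min ((C - hi) * d `^ beta / 2) ((lo - C^-1) * d `^ beta^-1 / 2))
                  (Num.min eps (eps / (2 * W))).
have k0 : 0 < k.
  by rewrite !lt_min eps0 !divr_gt0 ?mulr_gt0 ?subr_gt0 ?powR_gt0.
have k1 : 2 * k <= (C - hi) * d `^ beta.
  by rewrite mulrC -ler_pdivlMr // /k !ge_min lexx.
have k2 : 2 * k <= (lo - C^-1) * d `^ beta^-1.
  by rewrite mulrC -ler_pdivlMr // /k !ge_min lexx orbT.
have k3 : k <= eps by rewrite /k !ge_min lexx !orbT.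
have k4 : W * k <= eps / 2.
  rewrite mulrC -ler_pdivlMr //; have -> : eps / 2 / W = eps / (2 * W) by rewrite invfM mulrA.
  by rewrite /k !ge_min lexx !orbT.
have eps2 : 0 < eps / 2 by rewrite divr_gt0.
have [d3 d30 d3P] := unit_square_unif_continuous _ cDF _ eps2.
have [N N0 Nk] : exists2 N, (0 < N)%N & N%:R^-1 < Num.min (k / L) d3.
  have m0 : 0 < Num.min (k / L) d3 by rewrite lt_min d30 divr_gt0.
  exists (Num.truncn (Num.min (k / L) d3)^-1).+1 => //.
  by rewrite invf_plt ?posrE // truncnS_gt.
move: Nk; rewrite lt_min => /andP[Nk Nd3].
have q0 : 0 < N%:R :> R by rewrite ltr0n.
have {}Nk : L * N%:R^-1 <= k by rewrite mulrC -ler_pdivlMr // ltW.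
pose t := expansion e N.
have t01 y : 0 <= y <= 1 -> 0 <= t y <= 1 by exact: expansion_itv.
have t_near y : `|t y - y| <= N%:R^-1 by exact: expansion_near.
have ct : {within `[0, 1], continuous t}.
  by apply: continuous_subspaceT; exact: expansion_continuous.
pose G p := F p + w p.1 * (F (p.1, t p.2) + (-1) * F p).
pose DG p := DF p + (dw p.1 * (F (p.1, t p.2) + (-1) * F p) +
                     w p.1 * (DF (p.1, t p.2) + (-1) * DF p)).
have GE x y : G (x, y) = (1 - w x) * F (x, y) + w x * F (x, t y).
  by rewrite /G /=; ring.
have C1G : C1x G DG.
  have FtF := C1xD _ _ _ _ (C1x_comp_y _ _ t ct t01 FDF)
    (C1xM _ _ _ _ (C1x_cst (-1)) FDF).
  have := C1xD _ _ _ _ FDF (C1xM _ _ _ _ (C1x_x w dw wdw cdw) FtF).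
  by congr C1x; apply/funext => p; rewrite /DG /=; ring.
have FLip x y1 y2 : 0 <= x <= 1 -> 0 <= y1 <= 1 -> 0 <= y2 <= 1 ->
    `|F (x, y2) - F (x, y1)| <= L * `|y2 - y1|.
  wlog y12 : y1 y2 / y1 <= y2 => [H x01 y1I y2I|x01 /andP[y10 _] /andP[_ y21]].
    have [y12|/ltW y21] := leP y1 y2; first exact: H.
    by rewrite distrC [`|y2 - y1|]distrC; exact: H.
  have /andP[h1 h2] := FL x y1 y2 x01 y10 y12 y21.
  have D0 : 0 <= y2 - y1 by rewrite subr_ge0.
  by rewrite !ger0_norm //; apply: le_trans h1; rewrite mulr_ge0 // ltW.
have Ft_near x y : 0 <= x <= 1 -> 0 <= y <= 1 -> `|F (x, t y) - F (x, y)| <= k.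
  move=> x01 y01; apply: le_trans Nk; apply: (@le_trans _ _ (L * `|t y - y|)).
    exact: FLip x01 y01 (t01 y y01).
  by rewrite ler_pM2l.
have w_le x : `|w x| <= 1 by have /andP[? ?] := w01 x; rewrite ger0_norm.
have GF p : unit_square p -> `|G p - F p| <= k.
  case: p => x y /unit_squareP[x01 y01].
  have -> : G (x, y) - F (x, y) = w x * (F (x, t y) - F (x, y)) by rewrite GE; ring.
  by rewrite normrM -[k]mul1r ler_pM // Ft_near.
have DGF p : unit_square p -> `|DG p - DF p| <= eps.
  case: p => x y /unit_squareP[x01 y01].
  have -> : DG (x, y) - DF (x, y) = dw x * (F (x, t y) - F (x, y)) +
      w x * (DF (x, t y) - DF (x, y)) by rewrite /DG /=; ring.
  rewrite [eps]splitr (le_trans (ler_normD _ _)) // lerD // normrM.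
    by apply: le_trans k4; apply: ler_pM; rewrite ?WP ?Ft_near.
  rewrite -[eps / 2]mul1r ler_pM // ltW // d3P ?subrr ?normr0 //;
    try by apply/unit_squareP; rewrite ?t01.
  exact: le_lt_trans (t_near y) Nd3.
have GL x y1 y2 : 0 <= x <= 1 -> 0 <= y1 -> y1 < y2 -> y2 <= 1 ->
    l * e * (y2 - y1) <= G (x, y2) - G (x, y1) <= L / e * (y2 - y1).
  move=> x01 y10 y12 y21.
  have y1I : 0 <= y1 <= 1 by rewrite y10 (ltW (lt_le_trans y12 y21)).
  have y2I : 0 <= y2 <= 1 by rewrite y21 (ltW (le_lt_trans y10 y12)).
  have /andP[t1 t2] := expansion_lipschitz e e01 _ _ _ N0 (ltW y12).
  have /andP[ty10 _] := t01 _ y1I; have /andP[_ ty21] := t01 _ y2I.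
  have D0 : 0 < y2 - y1 by rewrite subr_gt0.
  have t12 : t y1 <= t y2.
    by rewrite -subr_ge0; apply: le_trans t1; rewrite mulr_ge0 // ltW.
  have /andP[f1 f2] := FL x _ _ x01 y10 (ltW y12) y21.
  have /andP[f3 f4] := FL x _ _ x01 ty10 t12 ty21.
  have /andP[w0 w1] := w01 x; have wC : 0 <= 1 - w x by rewrite subr_ge0.
  have -> : G (x, y2) - G (x, y1) = (1 - w x) * (F (x, y2) - F (x, y1)) +
     w x * (F (x, t y2) - F (x, t y1)) by rewrite !GE; ring.
  have -> : l * e * (y2 - y1) = (1 - w x) * (l * e * (y2 - y1)) +
     w x * (l * e * (y2 - y1)) by ring.
  have -> : L / e * (y2 - y1) = (1 - w x) * (L / e * (y2 - y1)) +
     w x * (L / e * (y2 - y1)) by ring.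
  have g1 : l * e * (y2 - y1) <= F (x, y2) - F (x, y1).
    apply: le_trans f1; rewrite -mulrA ler_pM2l // ler_piMl // ltW //.
  have g2 : F (x, y2) - F (x, y1) <= L / e * (y2 - y1).
    apply: (le_trans f2); rewrite -mulrA ler_pM2l // ler_peMl ?(ltW D0) //.
    by rewrite invf_ge1 // ltW.
  have g3 : l * e * (y2 - y1) <= F (x, t y2) - F (x, t y1).
    by apply: le_trans f3; rewrite -mulrA ler_pM2l.
  have g4 : F (x, t y2) - F (x, t y1) <= L / e * (y2 - y1).
    by apply: (le_trans f4); rewrite -mulrA ler_pM2l.
  by apply/andP; split; apply: lerD; apply: ler_wpM2l.
have GH x y1 y2 : 0 <= x <= 1 -> 0 <= y1 -> y1 < y2 -> y2 <= 1 ->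
    C^-1 * (y2 - y1) `^ beta^-1 <= G (x, y2) - G (x, y1) <= C * (y2 - y1) `^ beta.
  move=> x01 y10 y12 y21.
  have y1I : 0 <= y1 <= 1 by rewrite y10 (ltW (lt_le_trans y12 y21)).
  have y2I : 0 <= y2 <= 1 by rewrite y21 (ltW (le_lt_trans y10 y12)).
  have D0 : 0 < y2 - y1 by rewrite subr_gt0.
  (* Small lengths use the Lipschitz bounds of [G], large ones the closeness of [G] to [F]. *)
  have [Dd|dD] := leP (y2 - y1) d.
    have /andP[g1 g2] := GL x y1 y2 x01 y10 y12 y21.
    apply/andP; split.
      apply: le_trans g1; rewrite -(mulr_powRB1 (ltW D0)) ?invr_gt0 //.
      rewrite mulrCA mulrC ler_pM2r //; apply: d2P.
      by rewrite (ltW D0) (le_trans Dd) // ge_min lexx orbT.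
    apply: (le_trans g2).
    have {1}-> : y2 - y1 = (y2 - y1) `^ (1 - beta) * (y2 - y1) `^ beta.
      by rewrite -powRD subrK ?powRr1 ?(ltW D0) // oner_eq0.
    rewrite mulrA ler_wpM2r ?powR_ge0 //; apply: d1P.
    by rewrite (ltW D0) (le_trans Dd) // ge_min lexx.
  have /andP[f1 f2] := FH x y1 y2 x01 y10 y12 y21.
  have := GF (x, y1); have := GF (x, y2).
  rewrite !ler_norml => /(_ (proj2 (unit_squareP x y2) (conj x01 y2I))) /andP[h1 h2].
  move=> /(_ (proj2 (unit_squareP x y1) (conj x01 y1I))) /andP[h3 h4].
  have p1 : (C - hi) * d `^ beta <= (C - hi) * (y2 - y1) `^ beta.
    rewrite ler_pM2l ?subr_gt0 //; apply: ge0_ler_powR; rewrite ?nnegrE ?ltW //.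
  have p2 : (lo - C^-1) * d `^ beta^-1 <= (lo - C^-1) * (y2 - y1) `^ beta^-1.
    rewrite ler_pM2l ?subr_gt0 //; apply: ge0_ler_powR; rewrite ?nnegrE ?ltW ?invr_gt0 //.
  by clear - f1 f2 h1 h2 h3 h4 k1 k2 p1 p2; apply/andP; split; lra.
have G0 x y : t y = y -> G (x, y) = F (x, y) by move=> ty; rewrite GE ty; ring.
have t0 : t 0 = 0 by have := expansion_node e N 0 N0; rewrite mul0r.
have t1 : t 1 = 1.
  by have := expansion_node e N N N0; rewrite divff // gt_eqF.
have [|||g gP] := @bihol_exists R C beta alpha G DG C0 b0 C1G _ _ _ GH.
(* Since 0 <= a, the step vanishes at x = 0 and the left edge is unchanged. *)
- move=> y y01; rewrite GE wa // subr0 mul1r mul0r addr0; exact: Fl.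
- by move=> x x01; rewrite G0 // Fb.
- by move=> x x01; rewrite G0 // Ft.
exists g; split; last 2 first.
- by move=> p Mp; rewrite (gP p Mp).1 (le_trans (GF p Mp)).
- by move=> p Mp; rewrite (gP p Mp).2 DGF.
have gE x y : 0 <= x <= 1 -> 0 <= y <= 1 -> g (x, y) = G (x, y).
  by move=> x01 y01; apply: (gP (x, y) _).1; apply/unit_squareP.
(* On either side a cell contributes at most L e / N: for x <= a the function is [F] on a piece of
   length e / N; for x >= b it is [F] after [t], which contracts the remaining piece to length at
   most e / N. *)
exists N, e, (L * e); split=> // x x01 xab;
  apply: sum_le_const => // -[j jN] /=.
- have n1 := @node_itv R N j (leqW jN) N0; have n2 := inner_node_itv N j e jN e01.
  rewrite !gE // !GE wa // subr0 !mul1r !mul0r !addr0.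
  have /andP[n3 _] := n1; have /andP[_ n4] := n2.
  have n5 : j%:R / N%:R <= (j%:R + e) / N%:R by rewrite ler_pM2r ?invr_gt0 // lerDl ltW.
  have /andP[_ h] := FL x _ _ x01 n3 n5 n4.
  by apply: (le_trans h); rewrite -mulrBl addrAC subrr add0r mulrA.
- have n1 := @node_itv R N j.+1 jN N0; have n2 := inner_node_itv N j e jN e01.
  rewrite !gE // !GE wb // subrr !mul1r !mul0r !add0r.
  have /andP[n3 _] := t01 _ n2; have /andP[_ n4] := t01 _ n1.
  have e01' : 0 <= e < 1 by rewrite e1 ltW.
  move: n3 n4; rewrite /t expansion_node // expansion_cell // => n3 n4.
  have /andP[ce1 ce2] := cell_map_e e e01.
  have n5 : (j%:R + cell_map e e) / N%:R <= j.+1%:R / N%:R.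
    by rewrite ler_pM2r ?invr_gt0 // -natr1 lerD2l.
  have /andP[_ h] := FL x _ _ x01 n3 n5 n4.
  apply: (le_trans h); rewrite -mulrA ler_pM2l // -mulrBl ler_pM2r ?invr_gt0 //.
  by rewrite -natr1 opprD addrACA subrr add0r lerBlDr addrC -lerBlDr.
Qed.

(** Regularization and perturbation each cost d / 2 in the function and its x-derivative, and
    [dist_alpha_small] turns [d] into the radius of a ball. *)
Lemma dense_splitting (a b eta : R) : 0 <= a -> a < b -> 0 < eta ->
  dense [set f : T | splitting a b eta f].
Proof.
move=> a0' a_b eta0 O [f Of] oO.
have /nbhs_ballP[eps /= eps0 epsO] : nbhs f O by exact: open_nbhs_nbhs.
have [d d0 dP] := dist_alpha_small C1 a0 ab b1 _ eps0.
have d2 : 0 < d / 2 by rewrite divr_gt0.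
have [lo [hi [l [L [F [DF [[loC hiC l0 L0] rF Ff DFf]]]]]]] :=
  bihol_regularization C1 b0 b1 f _ d2.
have [g [gsep gF DgF]] := splitting_perturbation _ _ _ _ _ _ _ _ _ _
  a0' a_b eta0 d2 loC hiC l0 L0 rF.
exists g; split=> //; apply: epsO; apply: dP => p Mp.
- rewrite distrC -(subrKA (F p)) [d]splitr (le_trans (ler_normD _ _)) // lerD //.
    exact: gF.
  exact: Ff.
- rewrite distrC -(subrKA (DF p)) [d]splitr (le_trans (ler_normD _ _)) // lerD //.
    exact: DgF.
  exact: DFf.
Qed.

End splitting_open_dense.

(** * Splitting sets of leaves *)

Section strip.
Context {R : realType} {C beta alpha : R}.
Hypotheses (C1 : 1 < C) (b0 : 0 < beta).
Variable f : bihol_space C beta alpha.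
Notation leb := (@lebesgue_measure R).

Let C0 : 0 < C. Proof. exact: lt_trans ltr01 C1. Qed.

Lemma bihol_lt x y1 y2 : 0 <= x <= 1 -> 0 <= y1 <= 1 -> 0 <= y2 <= 1 ->
  (f (x, y1) < f (x, y2)) = (y1 < y2).
Proof.
have H x' z1 z2 : 0 <= x' <= 1 -> 0 <= z1 -> z1 < z2 -> z2 <= 1 ->
    f (x', z1) < f (x', z2).
  move=> x01 z10 z12 z21; have /andP[+ _] := bihol_incr C1 b0 f _ _ _ x01 z10 z12 z21.
  rewrite -subr_gt0; apply: lt_le_trans.
  by rewrite mulr_gt0 ?invr_gt0 // powR_gt0 // subr_gt0.
move=> x01 /andP[y10 y11] /andP[y20 y21].
have [y12|y21'|->] := ltgtP y1 y2; first exact: H.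
  by apply/negbTE; rewrite -leNgt ltW // H.
by rewrite ltxx.
Qed.

Lemma bihol_le x y1 y2 : 0 <= x <= 1 -> 0 <= y1 <= 1 -> 0 <= y2 <= 1 ->
  (f (x, y1) <= f (x, y2)) = (y1 <= y2).
Proof. by move=> x01 y1I y2I; rewrite !leNgt bihol_lt. Qed.

Lemma bihol_itv x y : 0 <= x <= 1 -> 0 <= y <= 1 -> 0 <= f (x, y) <= 1.
Proof.
move=> x01 y01; have [I0 I1] : 0 <= (0 : R) <= 1 /\ 0 <= (1 : R) <= 1.
  by rewrite !lexx ler01.
by rewrite -{1}(bihol_bot f x01) -(bihol_top f x01) !bihol_le.
Qed.

Lemma bihol_surj x z : 0 <= x <= 1 -> 0 <= z <= 1 ->
  exists2 y, 0 <= y <= 1 & f (x, y) = z.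
Proof.
move=> x01 z01.
have f01 : f (x, 0) <= f (x, 1) by rewrite bihol_bot // bihol_top // ler01.
have [|y y01 fy] := segment_continuous_le_surjective ler01 f01
  (bihol_continuous_y C1 b0 f x x01) (t := z).
  by rewrite bihol_bot // bihol_top.
by exists y.
Qed.

(** The union of the leaves starting in the intervals [j/N, (j+e)/N[, described by inequalities
    between measurable functions so that measurability is direct. *)
Definition strip (N : nat) (e : R) : set (plane R) :=
  \bigcup_(j in `I_N) [set p | 0 <= p.1 <= 1 /\
    f (p.1, j%:R / N%:R) <= p.2 < f (p.1, (j%:R + e) / N%:R)].

Lemma measurable_bihol_x (y : R) : 0 <= y <= 1 ->
  measurable_fun (`[0, 1] `*` setT : set (plane R)) (fun p : plane R => f (p.1, y)).
Proof.
move=> y01.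
have mI : measurable (`[0, 1] : set (measurableTypeR R)) by exact: measurable_itv.
apply: (@measurable_comp _ _ _ _ _ _ (`[0, 1] : set (measurableTypeR R))
  (fun x : measurableTypeR R => f (x, y) : measurableTypeR R) _ fst) => //.
- by move=> _ [p [pI _]] <-.
- apply: subspace_continuous_measurable_fun => //.
  have /subspace_continuousP cf := bihol_continuous C1 b0 f.
  apply/subspace_continuousP => x x01.
  apply: cvg_comp (cf (x, y) _); last by split.
  move=> P HP; have /nbhs_ballP[d /= d0 dP] :
    nbhs (x, y) (fun q => unit_square q -> P q) := HP.
  apply/nbhs_ballP; exists d => // x' xx' x'01; apply: dP; last by split.
  by split => //=; exact: ballxx.
- by apply: measurable_funS (measurable_fst); [exact: measurableT|].
Qed.

Lemma measurable_strip N e : 0 < e < 1 -> measurable (strip N e).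
Proof.
move=> e01; apply: bigcup_measurable => j /= jN.
have mD : measurable (`[0, 1] `*` setT : set (plane R)).
  by apply: measurableX => //; exact: measurable_itv.
have N0 : (0 < N)%N by exact: leq_ltn_trans jN.
have m1 := measurable_bihol_x _ (node_itv N j (leqW jN) N0).
have m2 := measurable_bihol_x _ (inner_node_itv N j e jN e01).
have m3 : measurable_fun (`[0, 1] `*` setT : set (plane R)) (fun p : plane R => p.2 : R).
  by apply: measurable_funS (measurable_snd); [exact: measurableT|].
have mtrue : measurable [set true] by [].
have M1 := measurable_fun_ler m1 m3 mD mtrue.
have M2 := measurable_fun_ltr m3 m2 mD mtrue.
rewrite (_ : [set p | _] = (`[0, 1] `*` setT `&`
   (fun p : plane R => f (p.1, j%:R / N%:R) <= p.2) @^-1` [set true]) `&`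
   (`[0, 1] `*` setT `&`
   (fun p : plane R => p.2 < f (p.1, (j%:R + e) / N%:R)) @^-1` [set true])).
  exact: measurableI.
apply/seteqP; split => p /=; rewrite in_itv /=.
  by move=> [-> /andP[-> ->]].
by move=> [[[-> _] ->] [_ ->]].
Qed.

(** Monotonicity of f (x, .) cancels [f] from the inequalities. The condition left on [y] does not
    involve [x], so strips are saturated by leaves. *)
Lemma strip_leaf N e x y : 0 < e < 1 -> 0 <= x <= 1 -> 0 <= y <= 1 ->
  strip N e (x, f (x, y)) <-> exists2 j, (j < N)%N & j%:R / N%:R <= y < (j%:R + e) / N%:R.
Proof.
move=> e01 x01 y01; split=> [[j /= jN [_]]|[j jN]].
  rewrite bihol_le ?bihol_lt ?inner_node_itv ?node_itv ?(leqW jN) ?(leq_ltn_trans _ jN) //.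
  by exists j.
move=> h; exists j => //=; split=> //.
by rewrite bihol_le ?bihol_lt ?inner_node_itv ?node_itv ?(leqW jN) ?(leq_ltn_trans _ jN).
Qed.

Lemma lebesgue_cover N (A : set R) (u v : nat -> R) : measurable A ->
  (forall j, (j < N)%N -> u j <= v j) ->
  A `<=` \bigcup_(j in `I_N) `[u j, v j[%classic ->
  (leb A <= (\sum_(j < N) (v j - u j))%:E)%E.
Proof.
move=> mA uv; rewrite bigcup_mkord => AS.
have mU : measurable (\big[setU/set0]_(j < N) `[u j, v j[%classic : set R).
  by apply: bigsetU_measurable => j _; exact: measurable_itv.
apply: (@le_trans _ _ (leb (\big[setU/set0]_(j < N) `[u j, v j[%classic))).
  by apply: le_measure; rewrite ?inE.
have mI j : (j < N)%N -> measurable (`[u j, v j[%classic : set R).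
  by move=> _; exact: measurable_itv.
apply: le_trans (Boole_inequality leb mI) _.
rewrite -sumEFin; apply: lee_sum => j _.
have := lebesgue_measure_itv `[u j, v j[; rewrite /= lte_fin => ->.
case: ifPn => [//|_]; rewrite lee_fin subr_ge0; exact: uv.
Qed.

Lemma strip_low N e x : 0 < e < 1 -> 0 <= x <= 1 ->
  (leb (xsection (strip N e) x) <= (low_mass f N e x)%:E)%E.
Proof.
move=> e01 x01.
apply: (lebesgue_cover N _ (fun j => f (x, j%:R / N%:R))
  (fun j => f (x, (j%:R + e) / N%:R))).
- exact: measurable_xsection (measurable_strip N e e01).
- move=> j jN; have N0 : (0 < N)%N by exact: leq_ltn_trans jN.
  rewrite bihol_le ?inner_node_itv ?node_itv ?(leqW jN) //.
  by rewrite ler_pM2r ?invr_gt0 ?ltr0n // lerDl; case/andP: e01 => /ltW.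
- move=> z; rewrite /xsection /= inE => -[j /= jN [_ fz]].
  by exists j => //=; rewrite in_itv.
Qed.

(** A point f (x, y) off the strip has [y] in the second piece of its cell. The end 1 is left out
    because it lies in no half-open cell. *)
Lemma strip_high N e x : (0 < N)%N -> 0 < e < 1 -> 0 <= x <= 1 ->
  (leb (`[0%R, 1%R[ `\` xsection (strip N e) x) <= (high_mass f N e x)%:E)%E.
Proof.
move=> N0 e01 x01; have q0 : 0 < N%:R :> R by rewrite ltr0n.
have /andP[e0 e1] := e01.
apply: (lebesgue_cover N _ (fun j => f (x, (j%:R + e) / N%:R))
  (fun j => f (x, j.+1%:R / N%:R))).
- apply: measurableD; first exact: measurable_itv.
  exact: measurable_xsection (measurable_strip N e e01).
- move=> j jN; rewrite bihol_le ?inner_node_itv ?node_itv //.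
  by rewrite ler_pM2r ?invr_gt0 // -natr1 lerD2l ltW.
- move=> z [/=]; rewrite in_itv /= => /andP[z0 z1] nz.
  have z01 : 0 <= z <= 1 by rewrite z0 ltW.
  have [y y01 fyz] := bihol_surj x z x01 z01; subst z.
  have I1 : 0 <= (1 : R) <= 1 by rewrite lexx ler01.
  have y1 : y < 1 by move: z1; rewrite -{1}(bihol_top f x01) bihol_lt.
  have [y0 _] := andP y01.
  have Ny0 : 0 <= y * N%:R by rewrite mulr_ge0.
  have /andP[h1 h2] := truncn_itv Ny0; set j := Num.truncn _ in h1 h2.
  have jN : (j < N)%N.
    by rewrite -(ltr_nat R) (le_lt_trans h1) // gtr_pMl.
  exists j => //=; rewrite in_itv /=.
  rewrite bihol_le ?bihol_lt ?inner_node_itv ?node_itv //.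
  rewrite ltr_pdivlMr // h2 andbT leNgt; apply/negP => yj; apply: nz.
  rewrite /xsection /= inE; apply/strip_leaf => //.
  by exists j => //; rewrite yj andbT ler_pdivrMr.
Qed.

Definition half_pow (n : nat) : R := 1 / (2 ^ (n + 1))%:R.

Lemma half_pow_gt0 n : 0 < half_pow n.
Proof. by rewrite divr_gt0 // ltr0n expn_gt0. Qed.

(** Borel-Cantelli, the bounds [half_pow] being summable. *)
Lemma lim_sup_half_pow (F : (set R)^nat) : (forall n, measurable (F n)) ->
  (forall n, (leb (F n) <= (half_pow n)%:E)%E) -> leb.-negligible (lim_sup_set F).
Proof.
move=> mF Fle; apply/negligibleP.
  apply: bigcap_measurable => // n _.
  by apply: bigcup_measurable => k _; exact: mF.
apply: lim_sup_set_cvg0 => //.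
apply: (@le_lt_trans _ _ (\sum_(n <oo) (half_pow n)%:E)%E).
  by apply: lee_nneseries => n *; [exact: measure_ge0|exact: Fle].
have /cvg_lim -> // := @cvg_geometric_eseries_half R 1 0.
by rewrite ltry.
Qed.

(** The set is the lim sup of the strips of the successive splittings; saturation by leaves passes
    to the lim sup. *)
Lemma separating_set a b : (forall m, splitting a b (half_pow m) f) ->
  exists E : set (plane R), [/\ measurable E,
    forall x y, 0 <= x <= 1 -> 0 <= y <= 1 -> E (x, f (x, y)) <-> E (0, y),
    forall x, 0 <= x <= 1 -> x <= a -> leb.-negligible (xsection E x) &
    forall x, 0 <= x <= 1 -> b <= x -> leb.-negligible (`[0, 1] `\` xsection E x)].
Proof.
move=> sep; have [N NP] := choice sep; have [e eP] := choice NP.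
pose S m := strip (N m) (e m).
have mS m : measurable (S m).
  by have [eta [_ e01 _ _ _]] := eP m; exact: measurable_strip.
have S_leaf m x y : 0 <= x <= 1 -> 0 <= y <= 1 -> S m (x, f (x, y)) <-> S m (0, y).
  move=> x01 y01; have [eta [_ e01 _ _ _]] := eP m.
  have I0 : 0 <= (0 : R) <= 1 by rewrite lexx ler01.
  have h0 := strip_leaf (N m) (e m) 0 y e01 I0 y01; rewrite bihol_left // in h0.
  have hx := strip_leaf (N m) (e m) x y e01 x01 y01.
  by split=> [/hx/h0|/h0/hx].
exists (lim_sup_set S); split.
- apply: bigcap_measurable => // n _.
  by apply: bigcup_measurable => k _; exact: mS.
- move=> x y x01 y01; split=> H n _; have [k nk Sk] := H n I; exists k => //.
    by rewrite -(S_leaf k x).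
  by apply/S_leaf.
- move=> x x01 xa; apply: (@negligibleS _ _ _ _ (lim_sup_set (fun m => xsection (S m) x))).
    move=> z; rewrite /xsection /= inE => H n _; have [k nk Sk] := H n I.
    by exists k => //=; rewrite inE.
  apply: lim_sup_half_pow => m; first exact: measurable_xsection (mS m).
  have [eta [N0 e01 etam lowf _]] := eP m.
  apply: le_trans (strip_low (N m) (e m) x e01 x01) _.
  by rewrite lee_fin (le_trans (lowf x x01 xa)) // ltW.
- move=> x x01 bx.
  pose D m : set R := `[0, 1[ `\` xsection (S m) x.
  (* The complement of a lim sup is the lim inf of the complements, which lies in their lim sup,
     where Borel-Cantelli applies. The point 1, not covered by [strip_high], is added separately. *)
  have sub : `[0, 1] `\` xsection (lim_sup_set S) x `<=` lim_sup_set D `|` [set 1].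
    move=> z [/=]; rewrite in_itv /= => /andP[z0 z1] nz.
    have [->|z1'] := eqVneq z 1; [by right|left => n _].
    apply: contrapT => H; apply: nz; rewrite /xsection /= inE => k _.
    exists (maxn n k); rewrite /= ?leq_maxr //.
    apply: contrapT => nS; apply: H; exists (maxn n k); rewrite /= ?leq_maxl //.
    split; first by rewrite /= in_itv /= z0 lt_neqAle z1'.
    by move=> /= zS; apply: nS; rewrite /xsection /= inE in zS.
  apply: (@negligibleS _ _ _ leb _ _ sub); apply: negligibleU; last first.
    apply/negligibleP; first exact: measurable_set1.
    exact: lebesgue_measure_set1.
  apply: lim_sup_half_pow => m.
    by apply: measurableD; [exact: measurable_itv|exact: measurable_xsection (mS m)].
  have [eta [N0 e01 etam _ highf]] := eP m.
  apply: le_trans (strip_high (N m) (e m) x N0 e01 x01) _.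
  by rewrite lee_fin (le_trans (highf x x01 bx)) // ltW.
Qed.

End strip.

(** * Failure of absolute continuity *)

Section vertical_transversals.
Context {R : realType}.
Notation leb := (@lebesgue_measure R).

Definition vertical (x : R) : R -> R * R := fun t => (x, t).

Lemma smooth_cst (c : R) : smooth (cst c).
Proof.
move=> n; elim: n c => [|n IH] c t; first exact: derivable_cst.
rewrite derive1Sn (_ : derive1 (cst c) = cst 0) //.
by apply/funext => z; rewrite derive1_cst.
Qed.

Lemma smooth_id : smooth (@id R).
Proof.
move=> [|n] t; first exact: derivable_id.
rewrite derive1Sn (_ : derive1 id = cst 1); first exact: smooth_cst.
by apply/funext => z; rewrite derive1_id.
Qed.

(** The first coordinate being constant, transversality to the leaves reduces to 1 != 0, whatever
    their slope. *)
Lemma vertical_transversal (f : R * R -> R) (x : R) : 0 <= x <= 1 ->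
  smooth_transversal f (vertical x).
Proof.
move=> x01; split.
- by split; [exact: smooth_cst|exact: smooth_id].
- by move=> t u _ _ [].
- by move=> _ [t t01 <-]; split.
- move=> t y _ _ _; rewrite (_ : snd \o vertical x = id) //.
  rewrite (_ : fst \o vertical x = cst x) // derive1_cst mulr0 derive1_id.
  exact: oner_neq0.
Qed.

Lemma arc_length_vertical (x : R) (A : set (plane R)) : measurable A ->
  arc_length (vertical x) A = leb (`[0, 1] `&` xsection A x).
Proof.
move=> mA; rewrite /arc_length.
have -> : vertical x @^-1` A = xsection A x.
  by apply/seteqP; split => t; rewrite /xsection /= inE.
have mD : measurable (`[0, 1] `&` xsection A x : set (measurableTypeR R)).
  by apply: measurableI; [exact: measurable_itv|exact: measurable_xsection].
under eq_integral => t _.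
  rewrite (_ : snd \o vertical x = id) // (_ : fst \o vertical x = cst x) //.
  rewrite derive1_cst derive1_id expr0n expr1n add0r sqrtr1.
  over.
by rewrite integral_cst // mul1e.
Qed.

(** The part of the right edge outside [E] is null, but by saturation its holonomy image contains
    the part of the left edge outside [E], which has full length. *)
Lemma not_absolutely_continuous (f : R * R -> R) (E : set (plane R)) :
  (forall y, 0 <= y <= 1 -> f (0, y) = y) ->
  (forall y, 0 <= y <= 1 -> E (1, f (1, y)) <-> E (0, y)) ->
  (forall y, 0 <= y <= 1 -> 0 <= f (1, y) <= 1) ->
  leb.-negligible (xsection E 0) ->
  leb.-negligible (`[0, 1] `\` xsection E 1) ->
  ~ absolutely_continuous_foliation f.
Proof.
move=> f_left E_leaf f01 E0 E1 ac.
have [I0 I1] : 0 <= (0 : R) <= 1 /\ 0 <= (1 : R) <= 1 by rewrite !lexx ler01.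
pose A : set (plane R) := [set p | p.1 = 1 /\ 0 <= p.2 <= 1 /\ ~ E p].
have A_vert : A `<=` vertical 1 @` `[0, 1].
  by move=> [x z] [/= -> [z01 _]]; exists z.
have A0 : (arc_length (vertical 1)).-negligible A.
  have [N [mN N0 EN]] := E1.
  exists (setT `*` N); split; first exact: measurableX.
    have mX : measurable (setT `*` N : set (plane R)) by exact: measurableX.
    rewrite arc_length_vertical // in_xsectionX ?inE //.
    apply/eqP; rewrite -measure_le0 -[leRHS]N0; apply: le_measure; rewrite ?inE //.
    by apply: measurableI => //; exact: measurable_itv.
  move=> [x z] [/= -> [z01 nE]]; split=> //=; apply: EN; split=> //=.
  by rewrite /xsection /= inE.
have [B [mB B0 hB]] := ac _ _ (vertical_transversal f 1 I1)
  (vertical_transversal f 0 I0) A A_vert A0.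
rewrite arc_length_vertical // in B0.
have : leb.-negligible (`[0, 1] : set R).
  (* The left edge would be covered by two null sets: [E] and the cover [B] of the holonomy
     image. *)
  apply: (@negligibleS _ _ _ leb (xsection E 0 `|` (`[0, 1] `&` xsection B 0))).
    move=> z z01; have [Ez|Ez] := pselect (E (0, z)).
      by left; rewrite /xsection /= inE.
    right; split => //; rewrite /xsection /= inE; apply: hB; split; first by exists z.
    exists (1, f (1, z)), (leaf f z); split.
    - split=> //; split; first exact: f01.
      by move/(E_leaf z z01).
    - by exists z.
    - by exists 1.
    - by exists 0 => //=; rewrite f_left.
  apply: negligibleU => //; apply/negligibleP => //.
  by apply: measurableI; [exact: measurable_itv|exact: measurable_xsection].
move=> /negligibleP => /(_ (measurable_itv _)).
have := lebesgue_measure_itv `[0 : R, 1]; rewrite /= lte_fin ltr01 oppr0 adde0.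
by move=> -> /eqP; rewrite eqe oner_eq0.
Qed.

End vertical_transversals.

(** * Conditional measures *)

Section dirac.
Context {R : realType}.
Notation leb := (@lebesgue_measure R).

Definition left_part (t : R) : set (plane R) := [set p | p.1 <= t].
Definition right_part (t : R) : set (plane R) := [set p | t <= p.1].

Lemma measurable_left_part t : measurable (left_part t).
Proof.
have -> : left_part t = (`]-oo, t] `*` setT : set (plane R)).
  by apply/seteqP; split => p; rewrite /left_part /= in_itv /=; [split|case].
by apply: measurableX => //; exact: measurable_itv.
Qed.

Lemma measurable_right_part t : measurable (right_part t).
Proof.
have -> : right_part t = (`[t, +oo[ `*` setT : set (plane R)).
  by apply/seteqP; split => p; rewrite /right_part /= in_itv /= andbT; [split|case].
by apply: measurableX => //; exact: measurable_itv.
Qed.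

(** The abscissa of the atom is the supremum of the [t] with null left part: both open sides of that
    abscissa are countable unions of null sets, and the graph of [u] fixes the ordinate. *)
Lemma dirac_of_splitting (nu : probability (plane R) R) (u : R -> R) :
  nu.-negligible (~` [set p : plane R | 0 <= p.1 <= 1 /\ p.2 = u p.1]) ->
  (forall q1 q2 : rat, 0 <= ratr q1 :> R -> ratr q1 < ratr q2 :> R ->
    nu.-negligible (left_part (ratr q1)) \/ nu.-negligible (right_part (ratr q2))) ->
  exists2 x, 0 <= x <= 1 & forall E : set (plane R), measurable E ->
    nu E = \d_((x, u x) : plane R) E.
Proof.
move=> nuL cut.
pose L := [set p : plane R | 0 <= p.1 <= 1 /\ p.2 = u p.1].
have nu_pos : ~ nu.-negligible [set: plane R].
  move=> /negligibleP => /(_ measurableT) nu0.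
  have : (1 : \bar R)%E = 0%E by rewrite -(probability_setT nu); exact: nu0.
  by move/eqP; rewrite eqe oner_eq0.
pose S := [set t | nu.-negligible (left_part t)].
have S_lt0 t : t < 0 -> S t.
  move=> t0; apply: negligibleS nuL => -[x z] /= xt [/andP[x0 _] _].
  by move: (le_lt_trans (le_trans x0 xt) t0); rewrite ltxx.
have S_ub t : S t -> t <= 1.
  move=> St; rewrite leNgt; apply/negP => t1; apply: nu_pos.
  apply: (@negligibleS _ _ _ nu (~` L `|` left_part t)); last exact: negligibleU.
  move=> p _; have [Lp|] := pselect (L p); [right|by left].
  by have [/andP[_ p1] _] := Lp; rewrite /left_part /= (le_trans p1) // ltW.
have S_down s t : s <= t -> S t -> S s.
  by move=> st; apply: negligibleS => p /= ps; exact: le_trans st.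
have supS : has_sup S.
  by split; [exists (-1); apply: S_lt0; rewrite ltrN10|exists 1 => t; exact: S_ub].
pose x0 := sup S.
have x0_ge0 : 0 <= x0.
  rewrite leNgt; apply/negP => x0_lt0.
  have /S_lt0 /(sup_upper_bound supS) : x0 / 2 < 0 by rewrite pmulr_llt0.
  by rewrite -/x0; lra.
have x0_le1 : x0 <= 1 by apply: ge_sup; [case: supS|move=> t; exact: S_ub].
have below t : t < x0 -> nu.-negligible (left_part t).
  move=> tx0; have e0 : 0 < x0 - t by rewrite subr_gt0.
  have [s Ss] := sup_adherent e0 supS; rewrite -/x0 opprB addrC subrK => ts.
  exact: S_down (ltW ts) Ss.
(* Take rationals x0 < q1 < q2 < t: the left part at [q1] is not null since [q1] exceeds the
   supremum, so the right part at [q2] is. *)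
have above t : x0 < t -> nu.-negligible (right_part t).
  move=> x0t; have [q2] := rat_in_itvoo x0t; rewrite in_itv /= => /andP[x0q2 q2t].
  have [q1] := rat_in_itvoo x0q2; rewrite in_itv /= => /andP[x0q1 q12].
  have q1_ge0 : 0 <= ratr q1 :> R by rewrite (le_trans x0_ge0) // ltW.
  have [Sq1|] := cut q1 q2 q1_ge0 q12.
    by have := sup_upper_bound supS Sq1; rewrite leNgt x0q1.
  apply: negligibleS => p /= tp; apply: le_trans tp; exact: ltW.
have nu_p0 : nu.-negligible (~` [set ((x0, u x0) : plane R)]).
  apply: (@negligibleS _ _ _ nu (~` L `|` (\bigcup_n left_part (x0 - n.+1%:R^-1) `|`
      \bigcup_n right_part (x0 + n.+1%:R^-1)))).
    move=> [x z] /= xz; have [Lp|] := pselect (L (x, z)); [right|by left].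
    have [/= _ zE] := Lp.
    have [xx0|xx0|xx0] := ltgtP x x0.
    + left; have d0 : 0 < x0 - x by rewrite subr_gt0.
      exists (Num.truncn (x0 - x)^-1) => //; rewrite /left_part /= lerBrDr -lerBrDl.
      by rewrite invf_ple ?posrE // ltW // truncnS_gt.
    + right; have d0 : 0 < x - x0 by rewrite subr_gt0.
      exists (Num.truncn (x - x0)^-1) => //; rewrite /right_part /= -lerBrDl.
      by rewrite invf_ple ?posrE // ltW // truncnS_gt.
    + by exfalso; apply: xz; rewrite zE xx0.
  apply: negligibleU => //; apply: negligibleU; apply: negligible_bigcup => n.
    by apply: below; rewrite ltrBlDr ltrDl invr_gt0.
  by apply: above; rewrite ltrDl invr_gt0.
exists x0; first by rewrite x0_ge0.
move=> E mE; rewrite diracE; have [Ep|Ep] := boolP ((x0, u x0) \in E).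
  have : nu (~` E) = 0%E.
    apply/negligibleP; first exact: measurableC.
    by apply: negligibleS nu_p0 => p nEp /= pE; apply: nEp; rewrite pE; exact: set_mem.
  rewrite probability_setC // => /eqP; rewrite sube_eq ?fin_num_measure //.
    by rewrite add0e => /eqP <-.
apply/negligibleP => //; apply: negligibleS nu_p0 => p Ep' /= pE.
by move/negP: Ep; apply; rewrite inE -pE.
Qed.

End dirac.

Section conditional.
Context {R : realType} {C beta alpha : R}.
Hypotheses (C1 : 1 < C) (b0 : 0 < beta).
Variable f : bihol_space C beta alpha.
Notation leb := (@lebesgue_measure R).

(** The product measure integrates the lengths of the vertical sections, all of which are zero. *)
Lemma square_measure_null (Z : set (plane R)) : measurable Z -> Z `<=` unit_square ->
  (forall x, 0 <= x <= 1 -> leb.-negligible (xsection Z x)) -> square_measure Z = 0%E.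
Proof.
move=> mZ ZM Z0; rewrite /square_measure /mrestr setIidl // /product_measure1.
apply: integral0_eq => x _ /=.
have mX : measurable (xsection Z x) by exact: measurable_xsection.
have [x01|nx01] := boolP (0 <= x <= 1); first by apply/negligibleP => //; exact: Z0.
rewrite (_ : xsection Z x = set0) ?measure0 //.
apply/seteqP; split => // z; rewrite /xsection /= inE => /ZM /unit_squareP[x01 _].
by rewrite x01 in nx01.
Qed.

Lemma measurable_graph y : 0 <= y <= 1 ->
  measurable [set p : plane R | 0 <= p.1 <= 1 /\ p.2 = f (p.1, y)].
Proof.
move=> y01.
have mD : measurable (`[0, 1] `*` setT : set (plane R)).
  by apply: measurableX => //; exact: measurable_itv.
have m1 := measurable_bihol_x C1 b0 f _ y01.
have m3 : measurable_fun (`[0, 1] `*` setT : set (plane R)) (fun p : plane R => p.2 : R).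
  by apply: measurable_funS (measurable_snd); [exact: measurableT|].
have mtrue : measurable [set true] by [].
have := measurable_fun_eqr m3 m1 mD mtrue.
congr measurable; apply/seteqP; split => p /=; rewrite in_itv /=.
  by move=> [[-> _] /eqP ->].
by move=> [-> /eqP ->].
Qed.

(** The nonnegative function P |-> mu_P (Z) has integral 0, hence vanishes almost everywhere. *)
Lemma conditional_null (mu_ : leaf_space f -> probability (plane R) R)
    (Z : set (plane R)) : conditional_measures mu_ ->
  measurable Z -> Z `<=` unit_square -> square_measure Z = 0%E ->
  {ae leaf_measure f, forall P, mu_ P Z = 0%E}.
Proof.
move=> [_ _ mmu intmu] mZ ZM Z0.
have : (\int[leaf_measure f]_P `|mu_ P Z| = 0)%E.
  rewrite -Z0 intmu //; apply: eq_integral => P _.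
  by rewrite gee0_abs.
move=> /(ae_eq_integral_abs (leaf_measure f) measurableT (mmu Z mZ ZM)).
by apply: filterS => P /= /(_ I).
Qed.

End conditional.

(** * Atomicity of the conditional measures *)

Section mono_atomic.
Context {R : realType} {C beta alpha : R}.
Hypotheses (C1 : 1 < C) (b0 : 0 < beta).
Variable f : bihol_space C beta alpha.

Lemma leaf_graph y : leaf f y = [set p : plane R | 0 <= p.1 <= 1 /\ p.2 = f (p.1, y)].
Proof.
apply/seteqP; split => [_ [x x01 <-]|[x z] [/= x01 ->]] //.
by exists x.
Qed.

Lemma full_leaf_negligible (nu : probability (plane R) R) y : 0 <= y <= 1 ->
  nu (leaf f y) = 1%E ->
  nu.-negligible (~` [set p : plane R | 0 <= p.1 <= 1 /\ p.2 = f (p.1, y)]).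
Proof.
move=> y01; rewrite leaf_graph => nu1; have mG := measurable_graph C1 b0 f y y01.
apply/negligibleP; first exact: measurableC.
by have := probability_setC nu mG; rewrite nu1 subee.
Qed.

(** With [E] the separating set, its part over x <= a and the part of its complement over x >= b are
    null on every vertical. A leaf inside [E] has its left part in the first, any other leaf has its
    right part in the second. *)
Lemma leaf_cut (a b : R) : (forall m, splitting a b (half_pow m) f) ->
  exists Z1 Z2 : set (plane R),
    [/\ measurable Z1 /\ measurable Z2, Z1 `<=` unit_square /\ Z2 `<=` unit_square,
        square_measure Z1 = 0%E /\ square_measure Z2 = 0%E &
        forall y, 0 <= y <= 1 -> leaf f y `&` left_part a `<=` Z1 \/
                                 leaf f y `&` right_part b `<=` Z2].
Proof.
move=> /(separating_set C1 b0 f)[E [mE E_leaf E0 E1]].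
have mM : measurable (unit_square : set (plane R)) by exact: measurable_unit_square.
pose Z1 : set (plane R) := unit_square `&` left_part a `&` E.
pose Z2 : set (plane R) := unit_square `&` right_part b `\` E.
have mZ1 : measurable Z1.
  by do 2?apply: measurableI => //; exact: measurable_left_part.
have mZ2 : measurable Z2.
  by apply: measurableD => //; apply: measurableI => //; exact: measurable_right_part.
have Z1M : Z1 `<=` unit_square by move=> p [[]].
have Z2M : Z2 `<=` unit_square by move=> p [[]].
exists Z1, Z2; split=> //.
- split; apply: square_measure_null => // x x01.
  + have [xa|ax] := leP x a.
      apply: negligibleS (E0 x x01 xa) => z; rewrite /xsection /= !inE.
      by case.
    apply: negligibleS (negligible_set0 _) => z; rewrite /xsection /= inE.
    by move=> [[_ /= xa] _]; move: ax; rewrite ltNge => /negP; apply.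
  + have [bx|xb] := leP b x.
      apply: negligibleS (E1 x x01 bx) => z; rewrite /xsection /= !inE.
      by move=> [[[_ zI] _] nE]; split => //; rewrite inE.
    apply: negligibleS (negligible_set0 _) => z; rewrite /xsection /= inE.
    by move=> [[_ /= xa] _]; move: xb; rewrite ltNge => /negP; apply.
- move=> y y01; have [Ey|Ey] := pselect (E (0, y)); [left|right].
    move=> _ [[x x01 <-] xa]; split; last exact/E_leaf.
    by split=> //; split => //; exact: (bihol_itv C1 b0).
  move=> _ [[x x01 <-] xa]; split; last by move/(E_leaf _ _ x01 y01).
  by split=> //; split => //; exact: (bihol_itv C1 b0).
Qed.

Lemma conditional_mono_atomic (mu_ : leaf_space f -> probability (plane R) R) :
  (forall (q1 q2 : rat) m, 0 <= ratr q1 :> R -> ratr q1 < ratr q2 :> R ->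
    splitting (ratr q1) (ratr q2) (half_pow m) f) ->
  conditional_measures mu_ -> {ae leaf_measure f, forall P, mono_atomic P (mu_ P)}.
Proof.
move=> sep cond; have [_ full _ _] := cond.
pose cut (q1 q2 : rat) P := 0 <= ratr q1 :> R -> ratr q1 < ratr q2 :> R ->
  (mu_ P).-negligible (left_part (ratr q1)) \/ (mu_ P).-negligible (right_part (ratr q2)).
(* Rational pairs are enumerated so that a single null set of leaves serves them all; indices coding
   no pair impose nothing. *)
pose Q n P := if unpickle n is Some q then cut q.1 q.2 P else True.
have ae_cut q1 q2 : \forall P \ae leaf_measure f, cut q1 q2 P.
  have [q1_ge0|nq1] := boolP (0 <= ratr q1 :> R); last first.
    by apply: aeW => P q1_ge0; rewrite q1_ge0 in nq1.
  have [q12|nq12] := boolP (ratr q1 < ratr q2 :> R); last first.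
    by apply: aeW => P _ q12; rewrite q12 in nq12.
  have [Z1 [Z2 [[mZ1 mZ2] [Z1M Z2M] [Z10 Z20] Zcut]]] :=
    leaf_cut _ _ (fun m => sep q1 q2 m q1_ge0 q12).
  have ae1 := conditional_null f mu_ Z1 cond mZ1 Z1M Z10.
  have ae2 := conditional_null f mu_ Z2 cond mZ2 Z2M Z20.
  apply: filterS3 full ae1 ae2 => P Pfull PZ1 PZ2 _ _.
  have [y y01 Py] := svalP P; rewrite -Py in Pfull.
  have nuL := full_leaf_negligible _ _ y01 Pfull; rewrite -leaf_graph in nuL.
  have [h|h] := Zcut y y01; [left|right].
    apply: (@negligibleS _ _ _ (mu_ P) (~` leaf f y `|` Z1)).
      by move=> p pa; have [Lp|] := pselect (leaf f y p); [right; apply: h|left].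
    by apply: negligibleU => //; apply/negligibleP.
  apply: (@negligibleS _ _ _ (mu_ P) (~` leaf f y `|` Z2)).
    by move=> p pa; have [Lp|] := pselect (leaf f y p); [right; apply: h|left].
  by apply: negligibleU => //; apply/negligibleP.
have aeQ : \forall P \ae leaf_measure f, forall n, Q n P.
  apply: ae_foralln => n; rewrite /Q.
  by case: unpickle => [q|]; [exact: ae_cut|exact: aeW].
apply: filterS2 full aeQ => P Pfull PQ.
have [y y01 Py] := svalP P; rewrite -Py in Pfull.
have nuL := full_leaf_negligible _ _ y01 Pfull.
have [|x x01 xE] := dirac_of_splitting (mu_ P) (fun x => f (x, y)) nuL.
  by move=> q1 q2; have := PQ (pickle (q1, q2)); rewrite /Q pickleK.
by exists (x, f (x, y)) => //; rewrite -Py; exists x.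
Qed.

End mono_atomic.

(** * The residual set and its two properties *)

Theorem theorem1p1 (R : realType) (C alpha beta : R)
    (C_gt1 : 1 < C) (alpha_ge0 : 0 <= alpha) (alpha_beta : alpha < beta)
    (beta_lt1 : beta < 1) :
  exists2 G : set (bihol_space C beta alpha), residual G &
    forall f : bihol_space C beta alpha, G f ->
      ~ absolutely_continuous_foliation f /\
      (forall mu_ : leaf_space f -> probability (plane R) R,
         conditional_measures mu_ ->
         {ae leaf_measure f, forall P, mono_atomic P (mu_ P)}).
Proof.
(* The conditions are indexed by codes of triples (q1, q2, m); an index coding no triple with 0 <=
   q1 < q2 gets the whole space, which is open and dense. *)
pose U (n : nat) : set (bihol_space C beta alpha) :=
  if (unpickle n : option (rat * rat * nat)) is Some (q1, q2, m) then
    if (0 <= ratr q1 :> R) && (ratr q1 < ratr q2 :> R) then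
      [set f | splitting (ratr q1) (ratr q2) (half_pow m) f]
    else setT
  else setT.
have b0 : 0 < beta by exact: le_lt_trans alpha_beta.
exists (\bigcap_n U n).
  exists U => // n; rewrite /U.
  have openT' : open [set: bihol_space C beta alpha] /\ dense [set: bihol_space C beta alpha].
    by split; [exact: openT|move=> O O0 _; rewrite setIT].
  case: unpickle => [[[q1 q2] m]|//]; case: ifPn => [/andP[q1_ge0 q12]|//].
  split; first exact: open_splitting.
  by apply: dense_splitting => //; exact: half_pow_gt0.
move=> f Gf.
have sep (q1 q2 : rat) m : 0 <= ratr q1 :> R -> ratr q1 < ratr q2 :> R ->
    splitting (ratr q1) (ratr q2) (half_pow m) f.
  move=> q1_ge0 q12; have := Gf (pickle (q1, q2, m)) I.
  by rewrite /U pickleK q1_ge0 q12.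
split; last by move=> mu_; exact: conditional_mono_atomic.
(* The case a = 0, b = 1 separates the two vertical edges of the square, which are the transversals
   used against absolute continuity. *)
have sep01 m : splitting (0 : R) 1 (half_pow m) f.
  by have := sep 0 1 m; rewrite rmorph0 rmorph1 lexx ltr01; apply.
have [E [_ E_leaf E0 E1]] := separating_set C_gt1 b0 f 0 1 sep01.
have [I0 I1] : 0 <= (0 : R) <= 1 /\ 0 <= (1 : R) <= 1 by rewrite !lexx ler01.
apply: (not_absolutely_continuous f E).
- by move=> y y01; exact: bihol_left.
- by move=> y y01; exact: E_leaf.
- by move=> y y01; exact: (bihol_itv C_gt1 b0).
- exact: E0.
- exact: E1.
Qed.
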